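(* Let $G$ be a finite simple graph without isolated vertices. Then $\frac{\beta(G)}{\alpha(G)}=\frac{5}{4}$ if and only if $G$ is an $S$-graph having a spanning $S$-forest $F$ that satisfies all of the following conditions: (a) no $1$-vertex of $F$ is incident to an edge of $B(G,F)$; (b) if a $1$-vertex $u$ of $F$ is incident to an edge of $\Delta(G,F)$, then the $2$-vertex $w$ of $F$ with $(u,w)\in U(F)$ is not incident to any edge of $B(G,F)$; (c) for every $L(F)$-$B(G,F)$ alternating even cycle $C$ of $G$ that contains a $2$-$2$ edge, the graph $C_{B(G,F)}$ is not bipartite.
   Context: All graphs are finite, undirected, without loops or multiple edges. A matching is a set of pairwise non-adjacent edges; $\beta(G)$ is the maximum size of a matching of $G$. Let $B_2(G)$ be the set of ordered pairs $(H,H')$ of disjoint matchings of $G$; $\lambda(G)=\max\{|H|+|H'|:(H,H')\in B_2(G)\}$ and $\alpha(G)=\max\{\max(|H|,|H'|):(H,H')\in B_2(G),\ |H|+|H'|=\lambda(G)\}$. The spanner is the tree on 10 vertices obtained from two paths $a_1b_1c_1d_1e_1$ and $a_2b_2c_2d_2e_2$ (each of length four, called sides) by adding the edge $c_1c_2$. In a spanner, a vertex of degree $i$ is an $i$-vertex ($a_j,e_j$ are $1$-vertices, $b_j,d_j$ are $2$-vertices, $c_j$ are $3$-vertices); the base of a vertex is the $3$-vertex nearest to it (e.g. the base of $a_1$ is $c_1$). $U(S)$ is the set of edges of the spanner $S$ incident to a $1$-vertex, and $L(S)$ is the set of edges not in $U(S)$ incident to a $2$-vertex (namely $b_jc_j,d_jc_j$).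 An $S$-forest is a forest each of whose connected components is a spanner; $i$-vertices, bases, and the sets $U(F)$, $L(F)$ (unions over components) are inherited from the components. An $S$-graph is a graph containing an $S$-forest $F$ as a spanning subgraph ($F$ is then a spanning $S$-forest). For $G$ with spanning $S$-forest $F$: an $i$-$j$ edge is an edge of $G$ joining an $i$-vertex and a $j$-vertex of $F$; $\Delta(G,F)$ is the set of edges of $G$ joining a $1$-vertex of $F$ to its base; $B(G,F)=E(G)\setminus(L(F)\cup U(F)\cup\Delta(G,F))$. A trail is a sequence $v_0,e_1,v_1,\dots,e_n,v_n$ with $e_j=(v_{j-1},v_j)$ and pairwise distinct edges; it is a cycle if $v_0=v_n$, and even if $n$ is even. For edge sets $A,B$, a trail is $A$-$B$ alternating if its edges alternately belong to $A\setminus B$ and $B\setminus A$. For such a cycle $C$, $C_{B}$ denotes the subgraph formed by the edges of $C$ lying in $B$. *)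

(* Defs.v *)
From mathcomp Require Import all_boot all_order all_algebra.

Set Implicit Arguments.
Unset Strict Implicit.
Unset Printing Implicit Defensive.

(* A graph on the finite vertex type T is a relation on T; it is simple when
   this relation is symmetric and irreflexive.  An edge is the set of its two
   end points. *)

Section Graph.

Variables (T : finType) (e : rel T).

Definition simple_graph : Prop := symmetric e /\ irreflexive e.

Definition no_isolated : Prop := forall x : T, exists y : T, e x y.

Definition edges : {set {set T}} :=
  [set d : {set T} | [exists x, exists y, e x y && (d == [set x; y])]].

Definition matching (M : {set {set T}}) : bool :=
  (M \subset edges) && trivIset M.

Definition beta : nat := \max_(M : {set {set T}} | matching M) #|M|.

Definition B2 : {set {set {set T}} * {set {set T}}} :=
  [set P | [&& matching P.1, matching P.2 & [disjoint P.1 & P.2]]].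

Definition lambda : nat := \max_(P in B2) (#|P.1| + #|P.2|).

Definition alpha : nat :=
  \max_(P in B2 | #|P.1| + #|P.2| == lambda) maxn #|P.1| #|P.2|.

Definition degree (x : T) : nat := #|[set y | e x y]|.

Definition walk (n : nat) (x y : T) : bool :=
  [exists p : n.-tuple T, path e x p && (last x p == y)].

(* #|T| when y is not reachable from x. *)
Definition dist (x y : T) : nat :=
  find (fun n => walk n x y) (iota 0 #|T|).

Definition acyclic : Prop := forall c : seq T, 2 < size c -> ~ ucycle e c.

(* The graph being simple, a trail is given by its vertices x, p_1, .., p_n. *)
Definition trail_edges (x : T) (p : seq T) : seq {set T} :=
  pairmap (fun y z => [set y; z]) x p.

Definition trail (x : T) (p : seq T) : Prop :=
  path e x p /\ uniq (trail_edges x p).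

Definition even_cycle (x : T) (p : seq T) : Prop :=
  [/\ trail x p, last x p = x & ~~ odd (size p)].

End Graph.

(* The boolean b tells which of A :\: B and B :\: A the first edge is in. *)
Definition alternating (T : finType) (A B : {set {set T}}) (s : seq {set T}) :
    Prop :=
  exists b : bool, forall i, i < size s ->
    nth set0 s i \in if odd i (+) b then B :\: A else A :\: B.

Definition bipartite (T : finType) (X : {set {set T}}) : Prop :=
  exists c : T -> bool, forall x y, [set x; y] \in X -> c x != c y.

(* (s, 0), .., (s, 4) are the vertices a, b, c, d, e of the side s. *)
Definition spanner : rel (bool * 'I_5) := fun x y =>
  if x.1 == y.1 then (x.2.+1 == y.2 :> nat) || (y.2.+1 == x.2 :> nat)
  else (x.2 == 2 :> nat) && (y.2 == 2 :> nat).

Definition S_forest (T : finType) (f : rel T) : Prop :=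
  [/\ simple_graph f,
      acyclic f &
      forall x : T, exists phi : bool * 'I_5 -> T,
        [/\ injective phi,
            forall y, connect f x y <-> exists i, phi i = y &
            forall i j, f (phi i) (phi j) = spanner i j]].

(* F is a spanning S-forest of G: both have vertex set T. *)
Definition spanning_S_forest (T : finType) (G F : rel T) : Prop :=
  S_forest F /\ subrel F G.

Section SGraph.

Variables (T : finType) (G F : rel T).

Definition ivertex (i : nat) (x : T) : bool := degree F x == i.

Definition is_base (x y : T) : bool :=
  [&& ivertex 3 y, connect F x y &
      [forall z, ivertex 3 z ==> (dist F x y <= dist F x z)]].

Definition U : {set {set T}} :=
  [set d in edges F | [exists x in d, ivertex 1 x]].

Definition L : {set {set T}} :=
  [set d in edges F :\: U | [exists x in d, ivertex 2 x]].

Definition Delta : {set {set T}} :=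
  [set d in edges G | [exists x, exists y,
     [&& d == [set x; y], ivertex 1 x & is_base x y]]].

Definition B : {set {set T}} := edges G :\: (L :|: U :|: Delta).

Definition cond_a : Prop :=
  forall u, ivertex 1 u -> ~ exists2 d, d \in B & u \in d.

Definition cond_b : Prop :=
  forall u w, ivertex 1 u -> (exists2 d, d \in Delta & u \in d) ->
    ivertex 2 w -> [set u; w] \in U ->
    ~ exists2 d, d \in B & w \in d.

Definition cond_c : Prop :=
  forall (x : T) (p : seq T),
    even_cycle G x p -> alternating L B (trail_edges x p) ->
    (exists y z, [/\ [set y; z] \in trail_edges x p,
                     ivertex 2 y & ivertex 2 z]) ->
    ~ bipartite [set d in trail_edges x p | d \in B].

End SGraph.

(* Main.v *)
Require Import Defs.
From mathcomp Require Import all_boot all_order all_algebra.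
From mathcomp Require Import zify.

(* Necessity. Let M be a maximum matching and (H, H') an optimal pair with #|H|
   = alpha for which M and H share as many edges as possible. Call x exposed if
   M covers it and H does not; there are at least 2 (beta - alpha) exposed
   vertices. By extremality the M-edge at an exposed x lies in H', and
   exchanging H and H' on the component K of x in H :|: H' shows that x is the
   only vertex of K missed by H and that K contains an edge of H in M and an
   edge of H outside M. Hence alpha >= 4 (beta - alpha), and if equality holds
   then each such K is a path on five vertices, the M-edge at its centre leads
   to the centre of another one, and H :|: H' :|: M is an S-forest. It is
   spanning and satisfies (a) and (b) because any violation yields vertex-
   disjoint paths which, coloured alternately, give a better pair. If a cycle C
   violated (c), replacing the L-edges of C by its B-edges in U :|: L would
   keep all degrees and leave the graph 2-edge-colourable, but with a component
   of three edges (the given 2-2 edge and two edges of U).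

   Sufficiency. Let T have 10 k vertices. Edges of Delta can be traded away in
   any pair (H, H'), after which 1-vertices have degree at most 1 in H :|: H',
   so that #|H| + #|H'| <= 8 k. In case of equality all degrees are the same as
   in U :|: L. If H :|: H' has no 2-2 edge, then H and H' have at least one
   edge for each of the 4 k 2-vertices; otherwise the symmetric difference of H
   :|: H' and U :|: L, in which every vertex is balanced, contains a cycle
   violating (c). *)

Set Implicit Arguments.
Unset Strict Implicit.
Unset Printing Implicit Defensive.

(** * Edge sets and the adjacency relation they define *)

Section EdgeSets.

Variable T : finType.
Implicit Types (x y z : T) (d : {set T}) (D M N H K : {set {set T}}).

Lemma set2_eqP x y u v :
  [set x; y] = [set u; v] -> (x = u /\ y = v) \/ (x = v /\ y = u).
Proof.
move=> E.
have /set2P[xu|xv] : x \in [set u; v] by rewrite -E set21.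
  have /set2P[yu|yv] : y \in [set u; v] by rewrite -E set22.
    have : v \in [set x; y] by rewrite E set22.
    by rewrite xu yu => /set2P[] ->; left.
  by left.
have /set2P[yu|yv] : y \in [set u; v] by rewrite -E set22.
  by right.
have : u \in [set x; y] by rewrite E set21.
by rewrite xv yv => /set2P[] ->; right.
Qed.

Lemma set2_inj x y z : [set x; y] = [set x; z] -> y = z.
Proof. by case/set2_eqP => [[]|[-> ->]]. Qed.

Definition adj D : rel T := fun x y => [set x; y] \in D.

Lemma adj_sym D : symmetric (adj D).
Proof. by move=> x y; rewrite /adj setUC. Qed.

Lemma connect_adj_sym D : connect_sym (adj D).
Proof. exact/sym_connect_sym/adj_sym. Qed.

Lemma connect_adj_r D x u v : [set u; v] \in D ->
  connect (adj D) x u = connect (adj D) x v.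
Proof. by move=> uv; apply: (same_connect_r (@connect_adj_sym D) (connect1 uv)).
  Qed.

Lemma in_cover D d x : d \in D -> x \in d -> x \in cover D.
Proof. by move=> dD xd; apply/bigcupP; exists d. Qed.

Lemma adj_cover D x y : [set x; y] \in D -> (x \in cover D) * (y \in cover D).
Proof. by move=> dD; split; apply: in_cover dD _; rewrite ?set21 ?set22. Qed.

Lemma coverS D N : D \subset N -> cover D \subset cover N.
Proof.
by move=> /subsetP DN; apply/subsetP => x /bigcupP[d /DN dN xd]; apply: in_cover xd.
Qed.

Lemma cover0 : cover (set0 : {set {set T}}) = set0.
Proof. by rewrite /cover big_set0. Qed.

Definition coloring (c : T -> bool) D :=
  forall x y, [set x; y] \in D -> c x != c y.

End EdgeSets.

(** * Matchings, and optimal pairs for [beta], [lambda] and [alpha] *)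

Section Matchings.

Variables (T : finType) (G : rel T).
Hypothesis hG : simple_graph G.
Implicit Types (x y z : T) (d : {set T}) (M N H : {set {set T}}).

Lemma edgeE x y : ([set x; y] \in edges G) = G x y.
Proof.
have [sG _] := hG; rewrite inE; apply/existsP/idP => [[u /existsP[v]]|Gxy].
  by case/andP=> Guv /eqP /set2_eqP[] [-> ->] //; rewrite sG.
by exists x; apply/existsP; exists y; rewrite Gxy eqxx.
Qed.

Lemma edgeP d : d \in edges G -> exists x y, G x y /\ d = [set x; y].
Proof. by rewrite inE => /existsP[x /existsP[y /andP[? /eqP ?]]]; exists x, y. Qed.

Lemma edge_at d x : d \in edges G -> x \in d -> exists y, G x y /\ d = [set x; y].
Proof.
have [sG _] := hG; move=> /edgeP[u [v [Guv ->]]] /set2P[]->; first by exists v.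
by exists u; rewrite sG setUC.
Qed.

Lemma edge_neq x y : G x y -> x != y.
Proof. by have [_ iG] := hG; move=> Gxy; apply: contraTneq Gxy => ->;
  rewrite iG. Qed.

Lemma card_edge d : d \in edges G -> #|d| = 2.
Proof. by move=> /edgeP[x [y [Gxy ->]]]; rewrite cards2 edge_neq. Qed.

Lemma edge_neq0 d : d \in edges G -> d != set0.
Proof. by move=> /card_edge dE; rewrite -card_gt0 dE. Qed.

Lemma matching_edge M d : matching G M -> d \in M -> d \in edges G.
Proof. by case/andP=> /subsetP sM _ /sM. Qed.

Lemma matching_adj M x y : matching G M -> [set x; y] \in M -> G x y.
Proof. by move=> mM /(matching_edge mM); rewrite edgeE. Qed.

Lemma matching_sub M N : N \subset M -> matching G M -> matching G N.
Proof.
move=> sNM /andP[sM tM]; rewrite /matching (subset_trans sNM sM) /=.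
exact: trivIsetS tM.
Qed.

Lemma matching0 : matching G set0.
Proof. by rewrite /matching sub0set; apply/trivIsetP => A B; rewrite inE. Qed.

Lemma matching_inj M d d' x : matching G M -> d \in M -> d' \in M ->
  x \in d -> x \in d' -> d = d'.
Proof.
case/andP=> _ /trivIsetP tM dM dM' xd xd'; apply/eqP; apply: contraT => /tM.
by move=> /(_ dM dM')/pred0P/(_ x); rewrite /= xd xd'.
Qed.

Lemma mate M x : matching G M -> x \in cover M -> exists y, [set x; y] \in M.
Proof.
move=> mM /bigcupP[d dM xd]; have [y [_ E]] := edge_at (matching_edge mM dM) xd.
by exists y; rewrite -E.
Qed.

Lemma mate_uniq M x y z : matching G M -> [set x; y] \in M -> [set x; z] \in M ->
  y = z.
Proof.
by move=> mM My Mz; apply: (@set2_inj _ x);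
  apply: (matching_inj mM My Mz (x := x)); rewrite set21.
Qed.

Lemma matching_union M N : matching G M -> matching G N ->
  [disjoint cover M & cover N] -> matching G (M :|: N).
Proof.
move=> mM mN dMN; case/andP: (mM) => sM tM; case/andP: (mN) => sN tN.
rewrite /matching subUset sM sN /=; apply/trivIsetP => A B.
have dis A' B' : A' \in M -> B' \in N -> [disjoint A' & B'].
  move=> AM BN; apply: disjointWl (disjointWr _ dMN); exact: bigcup_sup.
case/setUP=> hA /setUP[hB|hB] AB; first exact: (trivIsetP tM).
- exact: dis.
- by rewrite disjoint_sym; apply: dis.
- exact: (trivIsetP tN).
Qed.

Lemma matching_add M x y : matching G M -> G x y -> x \notin cover M ->
  y \notin cover M -> matching G ([set x; y] |: M).
Proof.
move=> mM Gxy xM yM; rewrite setUC; apply: matching_union => //.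
  rewrite /matching sub1set edgeE Gxy /=; apply/trivIsetP => A B.
  by rewrite !inE => /eqP-> /eqP->; rewrite eqxx.
rewrite /cover big_set1 disjoint_sym; apply/pred0P => z /=.
by rewrite !inE; apply/negP => /andP[/orP[]/eqP->]; apply/negP.
Qed.

Lemma cover_del M d x : matching G M -> d \in M -> x \in d ->
  x \notin cover (M :\ d).
Proof.
move=> mM dM xd; apply/negP => /bigcupP[d']; rewrite !inE => /andP[nd d'M] xd'.
by rewrite (matching_inj mM dM d'M xd xd') eqxx in nd.
Qed.

Lemma matching_weight M (w : T -> nat) : matching G M ->
  \sum_(d in M) \sum_(x in d) w x = \sum_(x in cover M) w x.
Proof. by case/andP=> _ tM; rewrite big_trivIset. Qed.

Lemma card_cover M : matching G M -> #|cover M| = #|M| * 2.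
Proof.
move=> mM; rewrite -sum1_card -matching_weight // -sum_nat_const.
by apply: eq_bigr => d dM; rewrite sum1_card (card_edge (matching_edge mM dM)).
Qed.

(** Every edge of [M] has exactly one end of colour [b], so counting those ends counts the edges. *)
Lemma card_color M c b : matching G M -> coloring c M ->
  #|M| = #|[set x in cover M | c x == b]|.
Proof.
move=> mM cM.
transitivity (\sum_(x in cover M) (c x == b : nat)).
  rewrite -(matching_weight _ mM) -[LHS]muln1 -sum_nat_const;
    apply: eq_bigr => d dM.
  have [x [y [Gxy E]]] := edgeP (matching_edge mM dM).
  have cxy : c x != c y by apply: cM; rewrite -E.
  rewrite E big_setU1 ?inE ?edge_neq //= big_set1.
  by case: (c x) cxy; case: (c y); case: b.
rewrite -big_mkcondr /= sum1dep_card; apply: eq_card => x.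
by rewrite !inE.
Qed.

Lemma pairP H H' : reflect [/\ matching G H, matching G H' & [disjoint H & H']]
  ((H, H') \in B2 G).
Proof. by rewrite inE; apply: and3P. Qed.

Lemma pair_sym H H' : (H, H') \in B2 G -> (H', H) \in B2 G.
Proof. by case/pairP=> ? ? ?; apply/pairP; split; rewrite // disjoint_sym. Qed.

Lemma pair_le_lambda H H' : (H, H') \in B2 G -> #|H| + #|H'| <= lambda G.
Proof.
move=> hP; rewrite /lambda.
exact: (@leq_bigmax_cond _ [in B2 G] (fun P => #|P.1| + #|P.2|) (H, H')).
Qed.

(** By [pair_le_lambda] the assumed inequality is an equality, so the pair competes in the
    definition of [alpha]. In this form a lower bound on the number of edges is all that has to be
    checked. *)
Lemma pair_le_alpha H H' : (H, H') \in B2 G -> lambda G <= #|H| + #|H'| ->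
  #|H| <= alpha G.
Proof.
move=> hP le; have E : #|H| + #|H'| == lambda G by rewrite eqn_leq pair_le_lambda.
apply: (@leq_trans (maxn #|H| #|H'|)); first exact: leq_maxl.
rewrite /alpha; apply: (@leq_bigmax_cond _ (fun P => (P \in B2 G) && (#|P.1| +
  #|P.2| == lambda G))
   (fun P => maxn #|P.1| #|P.2|) (H, H')).
by rewrite hP E.
Qed.

Lemma lambda_pair : exists H H', (H, H') \in B2 G /\ #|H| + #|H'| = lambda G.
Proof.
have h0 : (set0, set0) \in B2 G.
  by apply/pairP; split; rewrite ?matching0 // -setI_eq0 setI0.
have [|[H H'] hP E] := @eq_bigmax_cond _ [in B2 G] (fun P => #|P.1| + #|P.2|).
  by apply/card_gt0P; exists (set0, set0).
by exists H, H'; rewrite hP /lambda E.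
Qed.

(** A pair may be reversed, so the matching realizing [alpha] can be put first. *)
Lemma alpha_pair : exists H H',
  [/\ (H, H') \in B2 G, #|H| + #|H'| = lambda G & #|H| = alpha G].
Proof.
have [H0 [H0' [h0 E0]]] := lambda_pair.
have [|[H H'] hP E] := @eq_bigmax_cond _
  (fun P => (P \in B2 G) && (#|P.1| + #|P.2| == lambda G)) (fun P => maxn #|P.1|
    #|P.2|).
  by apply/card_gt0P; exists (H0, H0'); rewrite unfold_in /= h0 E0 eqxx.
case/andP: hP => hP /eqP /= El.
have {}E : alpha G = maxn #|H| #|H'| by rewrite /alpha E.
have [le|/ltnW le] := leqP #|H'| #|H|.
  by exists H, H'; rewrite E (maxn_idPl le).
by exists H', H; rewrite E (maxn_idPr le) addnC pair_sym.
Qed.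

Lemma lambda_le : lambda G <= alpha G * 2.
Proof.
have [H [H' [hP E]]] := lambda_pair.
have := pair_le_alpha hP; have := pair_le_alpha (pair_sym hP); lia.
Qed.

Lemma beta_matching : exists2 M, matching G M & #|M| = beta G.
Proof.
have [|M mM E] := @eq_bigmax_cond _ (matching G) (fun M : {set {set T}} => #|M|).
  by apply/card_gt0P; exists set0; apply: matching0.
by exists M; rewrite // /beta E.
Qed.

Lemma matching_le_beta M : matching G M -> #|M| <= beta G.
Proof. exact: (@leq_bigmax_cond _ (matching G) (fun M : {set {set T}} => #|M|)).
  Qed.

End Matchings.

(** * Degrees in an edge set *)

Section Degrees.

Variable T : finType.
Implicit Types (x : T) (d : {set T}) (D N : {set {set T}}).

Definition deg D x := #|[set d in D | x \in d]|.

Lemma degD1 D d x : d \in D -> x \in d -> deg D x = (deg (D :\ d) x).+1.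
Proof.
move=> dD xd; rewrite /deg (cardsD1 d) inE dD xd add1n; congr _.+1.
by apply: eq_card => d'; rewrite !inE andbA.
Qed.

Lemma degS D N x : D \subset N -> deg D x <= deg N x.
Proof.
move=> /subsetP DN; apply/subset_leq_card/subsetP => d.
by rewrite !inE => /andP[/DN-> ->].
Qed.

Lemma degU D N x : [disjoint D & N] -> deg (D :|: N) x = deg D x + deg N x.
Proof.
move=> dDN; rewrite /deg.
have -> : [set d in D :|: N | x \in d] = [set d in D | x \in d] :|: [set d in N |
  x \in d].
  by apply/setP => d; rewrite !inE andb_orl.
rewrite cardsU; set I := _ :&: _; suff -> : I = set0 by rewrite cards0 subn0.
apply/setP => d; rewrite !inE; apply/negP => /andP[/andP[dD _] /andP[dN _]].
by have /pred0P/(_ d) := dDN; rewrite /= dD dN.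
Qed.

Lemma degDI D N x : deg D x = deg (D :&: N) x + deg (D :\: N) x.
Proof.
rewrite -degU ?setID // -setI_eq0; apply/eqP/setP => d.
by rewrite !inE; case: (d \in N); rewrite ?andbF.
Qed.

Lemma deg_gt0 D x : (0 < deg D x) = (x \in cover D).
Proof.
apply/card_gt0P/bigcupP => [[d]|[d dD xd]]; last by exists d; rewrite inE dD.
by rewrite inE => /andP[]; exists d.
Qed.

End Degrees.

(** * Exchanges along components and 2-edge-colourings *)

Section Exchange.

Variables (T : finType) (G : rel T).
Hypothesis hG : simple_graph G.
Implicit Types (x y z : T) (d : {set T}) (K : {set T}) (D M N H : {set {set T}}).

Lemma matching_deg M x : matching G M -> deg M x = (x \in cover M).
Proof.
move=> mM; case: (boolP (x \in cover M)) => [|nx]; last first.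
  by apply/eqP; rewrite -leqn0 leqNgt deg_gt0.
case/(mate hG mM) => y Mxy; apply/eqP; rewrite /deg; apply/cards1P.
exists [set x; y]; apply/setP => d; rewrite !inE; apply/andP/eqP => [[dM xd]|->].
  by apply: (matching_inj mM dM Mxy xd); rewrite set21.
by rewrite Mxy set21.
Qed.

Lemma pair_deg H H' x : (H, H') \in B2 G ->
  deg (H :|: H') x = (x \in cover H) + (x \in cover H').
Proof. by case/pairP=> mH mH' dH; rewrite degU // !matching_deg. Qed.

Lemma pair_add H H' x y : (H, H') \in B2 G -> G x y -> [set x; y] \notin H' ->
  x \notin cover H -> y \notin cover H -> ([set x; y] |: H, H') \in B2 G.
Proof.
case/pairP=> mH mH' dH Gxy nd xH yH; apply/pairP; split => //.
  exact: matching_add.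
by rewrite -setI_eq0 setIUl setU_eq0 !setI_eq0 dH disjoints1 nd.
Qed.

Lemma pair_sub H H' N N' : (H, H') \in B2 G -> N \subset H -> N' \subset H' ->
  (N, N') \in B2 G.
Proof.
case/pairP=> mH mH' dH sN sN'; apply/pairP; split.
- exact: matching_sub sN mH.
- exact: matching_sub sN' mH'.
- exact: disjointWl sN (disjointWr sN' dH).
Qed.

Definition restr N K := [set d in N | d \subset K].

Lemma restr_sub N K : restr N K \subset N.
Proof. by apply/subsetP => d; rewrite inE => /andP[]. Qed.

Lemma cover_restr N K x : x \in cover (restr N K) -> x \in K.
Proof. by case/bigcupP=> d; rewrite inE => /andP[_ /subsetP sd] /sd. Qed.

(** * Interchanging two matchings on a union of components *)

Section Swap.

Variables (H H' : {set {set T}}) (K : {set T}).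
Hypotheses (pP : (H, H') \in B2 G) (clK : closed (adj (H :|: H')) K).

(** A closed [K] is a union of components of [H :|: H'], so an edge that meets [K] lies inside
    it. *)
Lemma closed_restr N d x : N \subset H :|: H' -> d \in N -> x \in d ->
  (d \in restr N K) = (x \in K).
Proof.
case/pairP: pP => mH mH' dH /subsetP sN dN xd; rewrite inE dN /=.
have dE : d \in edges G.
  by case/setUP: (sN _ dN); [apply: (matching_edge mH) | apply: (matching_edge
    mH')].
have [y [_ E]] := edge_at hG dE xd; have := sN _ dN; rewrite E => /clK xy.
by rewrite subUset !sub1set -xy andbb.
Qed.

Lemma cover_restr_closed N x : N \subset H :|: H' -> x \in K ->
  (x \in cover (restr N K)) = (x \in cover N).
Proof.
move=> sN xK; apply/idP/idP; first exact/subsetP/coverS/restr_sub.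
by case/bigcupP=> d dN xd; apply: (in_cover _ xd); rewrite (closed_restr sN dN xd).
Qed.

Lemma cover_restrD N x : N \subset H :|: H' -> x \in cover (N :\: restr N K) ->
  x \notin K.
Proof.
move=> sN /bigcupP[d /setDP[dN nd] xd]; apply: contra nd.
by rewrite (closed_restr sN dN xd).
Qed.

(** The Kempe exchange: [swap H H'] and [swap H' H] differ from [H] and [H'] only in that the two
    have traded their edges inside [K]. *)
Definition swap (N N' : {set {set T}}) := (N :\: restr N K) :|: restr N' K.

Lemma swap_matching N N' : N \subset H :|: H' -> matching G N -> matching G N' ->
  matching G (swap N N').
Proof.
move=> sN mN mN'; apply: matching_union.
- exact: matching_sub (subsetDl _ _) mN.
- exact: matching_sub (restr_sub _ _) mN'.
apply/pred0P => x /=; apply/negP => /andP[/(cover_restrD sN)/negP xK].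
by move=> /cover_restr /xK.
Qed.

Lemma swapped_pair : (swap H H', swap H' H) \in B2 G.
Proof.
case/pairP: (pP) => mH mH' dH; apply/pairP; split.
- by apply: swap_matching; rewrite ?subsetUl.
- by apply: swap_matching; rewrite ?subsetUr.
apply/pred0P => d /=; apply/negP; rewrite !inE.
have /pred0P/(_ d) /= := dH; case: (d \in H); case: (d \in H') => //=;
by rewrite ?andbF ?orbF ?andbT ?andNb ?andbN.
Qed.

Lemma swap_union : swap H H' :|: swap H' H = H :|: H'.
Proof.
apply/setP => d; rewrite !inE.
by case: (d \in H); case: (d \in H'); case: (d \subset K).
Qed.

(** Written as an equality of sums to avoid truncated subtraction. *)
Lemma swap_card : #|swap H H'| + #|restr H K| = #|H| + #|restr H' K|.
Proof.
case/pairP: (pP) => _ _ dH; rewrite /swap cardsU.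
have -> : (H :\: restr H K) :&: restr H' K = set0.
  apply/setP => d; rewrite !inE; have /pred0P/(_ d) /= := dH.
  by case: (d \in H) => //= ->; rewrite andbF.
rewrite cards0 subn0 cardsD (setIidPr (restr_sub _ _)).
by have := subset_leq_card (restr_sub H K); lia.
Qed.

End Swap.

(* Starting at [x], follow edges of [H'] out of the colour class of [x] and
   edges of [H] out of the other class. *)
Lemma connect_cover H H' c x y : matching G H -> matching G H' ->
  coloring c (H :|: H') -> x \notin cover H -> connect (adj (H :|: H')) x y ->
  y != x -> y \in cover (if c y == c x then H else H').
Proof.
move=> mH mH' cP xH cxy yx.
pose r v w := if c v == c x then [set v; w] \in H' else [set v; w] \in H.
have rD v w : r v w -> c v != c w.
  by rewrite /r => h; apply: cP; rewrite inE; case: ifP h => _ ->; rewrite ?orbT.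
have pred v : connect r x v -> v != x -> exists2 u, connect r x u & r u v.
  case/connectP=> p; case/lastP: p => [|p w] /=; first by move=> _ ->; rewrite eqxx.
  rewrite rcons_path last_rcons => /andP[px rw] -> _; exists (last x p) => //.
  by apply/connectP; exists p.
(* The vertices reached by [r] are closed under adjacency: an edge at [v] that [r] does not follow
   is of the kind by which [v] was entered, hence leads back to the predecessor [u]. So [r] reaches
   the whole component, and the kind of the last edge into [y] tells which matching covers [y]. *)
have step v w : connect r x v -> [set v; w] \in H :|: H' -> connect r x w.
  move=> cv vw.
  have [rvw|nr] := boolP (r v w); first exact: connect_trans cv (connect1 rvw).
  have vx : v != x.
    apply: contraNneq nr => vx; subst v; rewrite /r eqxx.
    by case/setUP: vw => // /adj_cover[h _]; rewrite h in xH.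
  have [u cu ruv] := pred _ cv vx; have := rD _ _ ruv; move: vw nr ruv;
    rewrite inE /r.
  case: ifP => [/eqP->|cvx].
    case/orP=> [hH|->] // _; case: ifP => // _.
    by rewrite setUC => hu _; rewrite (mate_uniq mH hH hu).
  case/orP=> [->|hH] // _; case: ifP => [_|cux].
    by rewrite setUC => hu _; rewrite (mate_uniq mH' hH hu).
  by case: (c u) (c v) (c x) cux cvx => [] [] [].
have cl : closed (adj (H :|: H')) [set v | connect r x v].
  apply: intro_closed; first exact: connect_adj_sym.
  by move=> v w vw; rewrite !inE => cv; apply: step cv vw.
have cy : connect r x y by have := closed_connect cl cxy;
  rewrite !inE connect0 => <-.
have [u _ ruy] := pred _ cy yx; have := rD _ _ ruy; move: ruy; rewrite /r.
case: ifP => [/eqP->|cux] uy; first by rewrite eq_sym => /negPf->;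
  case: (adj_cover uy).
case: ifP => [_ _|cyx cuy]; first by case: (adj_cover uy).
by case: (c u) (c y) (c x) cux cyx cuy => [] [] [].
Qed.


(** If the ends [x] and [y] of [d] have equal colours, the colours are flipped on the component of
    [x] in the graph without [d]. It does not contain [y]: by [connect_cover], with the two
    matchings interchanged, [H' :\ d] would cover [y]. *)
Lemma coloring_add H H' c d : matching G H -> matching G H' -> d \in H' ->
  coloring c (H :|: H' :\ d) -> exists c', coloring c' (H :|: H').
Proof.
move=> mH mH' dH' cP; have [x [y [Gxy E]]] := edgeP (matching_edge mH' dH').
have mD : matching G (H' :\ d) by apply: matching_sub (subD1set _ _) mH'.
have xD : x \notin cover (H' :\ d) by apply: cover_del mH' dH' _; rewrite E set21.
have yD : y \notin cover (H' :\ d) by apply: cover_del mH' dH' _; rewrite E set22.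
have UE : H :|: H' = d |: (H :|: H' :\ d) by rewrite setUCA setD1K.
pose c' v := if connect (adj (H :|: H' :\ d)) x v then (c x == c y) (+) c v else
  c v.
exists c' => u v; rewrite UE => /setU1P[|uv]; last first.
  rewrite /c' (connect_adj_r x uv).
  by have := cP _ _ uv; case: (connect _ _ _) => //; 
    case: (c u); case: (c v); case: (c x == c y).
have cxy : c' x != c' y.
  rewrite /c' connect0; case: (boolP (connect _ _ _)) => [cy|_]; last first.
    by case: (c x); case: (c y).
  have yx : y != x by rewrite eq_sym (edge_neq hG Gxy).
  have := connect_cover (H := H' :\ d) (H' := H) (c := c) mD mH; rewrite setUC.
  move=> /(_ _ _ cP xD cy yx); rewrite [c y == _]eq_sym; case: ifP => [_|].
    by rewrite (negPf yD).
  by move=> nc _; rewrite !addFb nc.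
by rewrite E => /set2_eqP[] [-> ->] //; rewrite eq_sym.
Qed.

Lemma two_matchings_bipartite H H' : matching G H -> matching G H' ->
  exists c, coloring c (H :|: H').
Proof.
move: {2}(#|H| + #|H'|) (leqnn (#|H| + #|H'|)) => n.
elim: n H H' => [|n IHn] H H' le mH mH'.
  have /andP[/eqP hH /eqP hH'] : (#|H| == 0) && (#|H'| == 0)
    by rewrite -addn_eq0 -leqn0.
  by exists xpred0 => x y; rewrite (cards0_eq hH) (cards0_eq hH') !inE.
have [H'0|[d dH']] := set_0Vmem H'.
  have [H0|[d dH]] := set_0Vmem H; first by exists xpred0 => x y;
    rewrite H0 H'0 !inE.
  have [||c cP] := IHn (H :\ d) H' _ _ mH'; first by have := cardsD1 d H;
    rewrite dH; lia.
    exact: matching_sub (subD1set _ _) mH.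
  rewrite setUC in cP; have [c' cP'] := coloring_add mH' mH dH cP.
  by exists c'; rewrite setUC.
have [||c cP] := IHn H (H' :\ d) _ mH _; first by have := cardsD1 d H';
  rewrite dH'; lia.
  exact: matching_sub (subD1set _ _) mH'.
exact: coloring_add cP.
Qed.

Definition colorable D := exists H H', (H, H') \in B2 G /\ H :|: H' = D.

Lemma colorable_add H H' x y : (H, H') \in B2 G -> G x y ->
  [set x; y] \notin H :|: H' -> x \notin cover H -> y \notin cover H ->
  colorable ([set x; y] |: (H :|: H')).
Proof.
move=> pP Gxy; rewrite inE negb_or => /andP[_ nd'] xH yH.
by exists ([set x; y] |: H), H'; rewrite pair_add // setUA.
Qed.

Lemma colorable_addC H H' x y : (H, H') \in B2 G -> G x y ->
  [set x; y] \notin H :|: H' -> x \notin cover H' -> y \notin cover H' ->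
  colorable ([set x; y] |: (H :|: H')).
Proof. by move=> /pair_sym; rewrite [H :|: H']setUC; apply: colorable_add. Qed.

(** König's edge-colouring theorem for maximum degree two, by adding an edge [d] with ends [x] and
    [y] to a coloured graph. Each end is missed by a matching. If [x] is missed only by [H] and [y]
    only by [H'], the matchings are interchanged on the component of [x]; it avoids [y], because
    [connect_cover] and the opposite colour of [y] would make [H'] cover [y]. *)
Lemma koenig c D : D \subset edges G -> coloring c D -> (forall x, deg D x <= 2) ->
  colorable D.
Proof.
move: {2}#|D| (leqnn #|D|) => n.
elim: n D => [|n IHn] D le sD cD dD.
  exists set0, set0; rewrite setU0 (cards0_eq (_ : #|D| = 0)); last by lia.
  by split=> //; apply/pairP; rewrite ?matching0 // -setI_eq0 setI0.
have [D0|[d hd]] := set_0Vmem D.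
  by apply: IHn => //; rewrite D0 cards0.
have [x [y [Gxy E]]] := edgeP (subsetP sD _ hd).
have sDd := subD1set D d.
have [|||x'|H [H' [pP UE]]] := IHn (D :\ d).
- by have := cardsD1 d D; rewrite hd; lia.
- exact: subset_trans sDd sD.
- by move=> u v /(subsetP sDd); apply: cD.
- exact: leq_trans (degS _ sDd) (dD _).
have nd : [set x; y] \notin H :|: H' by rewrite UE -E !inE eqxx.
have one v : v \in d -> (v \notin cover H) || (v \notin cover H').
  move=> vd; have := dD v; rewrite (degD1 hd vd) -UE (pair_deg _ pP).
  by case: (_ \in _); case: (_ \in _).
rewrite -(setD1K hd) -UE E.
have cU : coloring c (H :|: H') by move=> u v; rewrite UE => /(subsetP sDd);
  apply: cD.
wlog xH : H H' pP UE nd one cU / x \notin cover H.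
  move=> W; have /orP[xH|xH] : (x \notin cover H) || (x \notin cover H').
    by apply: one; rewrite E set21.
  - exact: W.
  - rewrite [H :|: H']setUC; apply: W => //; rewrite ?[H' :|: _]setUC //.
    + exact: pair_sym.
    + by move=> v /one; rewrite orbC.
have [yH|] := boolP (y \in cover H); last exact: colorable_add.
have yH' : y \notin cover H' by have := one y; rewrite E set22 yH /=; apply.
have [mH mH' _] := pairP _ _ _ pP.
pose K := [set v | connect (adj (H :|: H')) x v].
have clK : closed (adj (H :|: H')) K.
  by move=> u v uv; rewrite !inE; apply: connect_adj_r.
have yK : y \notin K.
  rewrite inE; apply: contra yH' => cxy.
  have yx : y != x by rewrite eq_sym (edge_neq hG Gxy).
  have := connect_cover mH mH' cU xH cxy yx.
  by have := cD x y; rewrite -E hd eq_sym => /(_ isT)/negPf->.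
rewrite -(swap_union H H' K); rewrite -(swap_union H H' K) in nd.
apply: (colorable_addC (swapped_pair pP clK)) => //.
  rewrite /swap /cover bigcup_setU inE negb_or -!/(cover _); apply/andP; split.
    apply/negP => /(cover_restrD pP clK (subsetUr _ _)).
    by rewrite inE connect0.
  by apply: contra xH; apply/subsetP/coverS/restr_sub.
rewrite /swap /cover bigcup_setU inE negb_or -!/(cover _); apply/andP; split.
  by apply: contra yH'; apply/subsetP/coverS/subsetDl.
by apply: contra yK => /cover_restr.
Qed.

(** The edges of [N] are coloured last. Such an edge is alone at one of its ends and meets at most
    one other edge at the other end, so one of the two matchings can take it. *)
Lemma colorable_greedy D N : D \subset edges G -> N \subset D ->
  (forall x, deg D x <= 2) -> (forall d, d \in N ->
    exists2 x, x \in d & deg D x = 1) ->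
  colorable (D :\: N) -> colorable D.
Proof.
move: {2}#|N| (leqnn #|N|) => n.
elim: n D N => [|n IHn] D N le sD sN dD dN.
  by rewrite (cards0_eq (_ : #|N| = 0)) ?setD0 //; lia.
have [->|[d hd]] := set_0Vmem N; first by rewrite setD0.
have dinD := subsetP sN _ hd; have sDd := subD1set D d.
have -> : D :\: N = (D :\ d) :\: (N :\ d).
  by apply/setP => d'; rewrite !inE; case: eqVneq => [->|]; rewrite ?hd.
move=> cD; have [||||d'|H [H' [pP UE]]] := IHn (D :\ d) (N :\ d) _ _ _ _ _ cD.
- by have := cardsD1 d N; rewrite hd; lia.
- exact: subset_trans sDd sD.
- exact: setSD.
- by move=> x; apply: leq_trans (degS _ sDd) (dD _).
(* Deleting [d] leaves the degree of [x] at 1, since [d'] itself remains at [x]. *)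
- case/setD1P=> nd' d'N; have [x xd' dx] := dN _ d'N; exists x => //; apply/eqP.
  rewrite eqn_leq -{1}dx degS //= deg_gt0; apply: in_cover xd'.
  by rewrite !inE nd' (subsetP sN).
have [x xd dx] := dN _ hd.
have [y [Gxy E]] := edge_at hG (subsetP sD _ dinD) xd.
have nd : [set x; y] \notin H :|: H' by rewrite UE -E !inE eqxx.
have := degD1 dinD xd; rewrite dx -UE (pair_deg _ pP) => -[].
case: (boolP (x \in cover H)) (boolP (x \in cover H')) => // xH [] // xH' _.
have := dD y; rewrite (degD1 dinD (_ : y \in d)) -?UE ?(pair_deg _ pP); last first.
  by rewrite E set22.
rewrite -(setD1K dinD) -UE E.
case: (boolP (y \in cover H)) (boolP (y \in cover H')) => // yH [] // yH' _.
- exact: colorable_addC.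
- exact: colorable_add.
- exact: colorable_add.
Qed.

End Exchange.

(* The vertices of a spanner are numbered so that [0 - 1 - 2 - 3 - 4] and
   [5 - 6 - 7 - 8 - 9] are its sides and [2 - 7] is the edge joining them. *)
Definition nb (i : nat) : seq nat :=
  nth [::] [:: [:: 1]; [:: 0; 2]; [:: 1; 3; 7]; [:: 2; 4]; [:: 3];
               [:: 6]; [:: 5; 7]; [:: 6; 8; 2]; [:: 7; 9]; [:: 8]] i.

(** * Charts of spanner components *)

Section Charts.

Variables (T : finType) (F : rel T).
Hypothesis sF : symmetric F.
Implicit Types (x y z : T) (phi : nat -> T) (W : {set T}).

(** The second condition lists all neighbours of [phi i] in [F], so the image is an entire component
    and not merely a copy of the spanner inside one. *)
Definition chart phi :=
  {in gtn 10 &, injective phi} /\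
  forall i z, i < 10 -> F (phi i) z = (z \in map phi (nb i)).

Definition sspan phi : {set T} := [set x in map phi (iota 0 10)].

Lemma spanP phi x : reflect (exists2 i, i < 10 & x = phi i) (x \in sspan phi).
Proof.
rewrite inE; apply: (iffP mapP) => -[i]; first by rewrite mem_iota; exists i.
by move=> lti ->; exists i; rewrite // mem_iota.
Qed.

Lemma mem_span phi i : i < 10 -> phi i \in sspan phi.
Proof. by move=> lti; apply/spanP; exists i. Qed.

Lemma nb_lt i j : j \in nb i -> j < 10.
Proof. by do 10?[case: i => [|i]]; rewrite /nb /= ?nth_nil ?inE // => h; lia. Qed.

Lemma chart_adj phi i j : chart phi -> i < 10 -> j \in nb i -> F (phi i) (phi j).
Proof. by move=> [_ h] lti ji; rewrite h // map_f. Qed.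

Lemma chart_nb phi i j : chart phi -> i < 10 -> j < 10 ->
  F (phi i) (phi j) = (j \in nb i).
Proof.
move=> [inj h] lti ltj; rewrite h //; apply/mapP/idP => [[k kn]|]; last by exists j.
by move/inj => -> //; apply: nb_lt kn.
Qed.

Lemma card_span phi : chart phi -> #|sspan phi| = 10.
Proof.
move=> [inj _]; rewrite cardsE -[RHS](size_iota 0 10) -(size_map phi);
  apply/card_uniqP.
by rewrite map_inj_in_uniq ?iota_uniq // => i j; rewrite !mem_iota; apply: inj.
Qed.

Lemma span_closed phi x y : chart phi -> x \in sspan phi -> F x y ->
  y \in sspan phi.
Proof.
move=> [_ h] /spanP[i lti ->]; rewrite h // => /mapP[j /nb_lt ltj ->].
exact: mem_span.
Qed.

Lemma span_connect phi x y : chart phi -> x \in sspan phi -> y \in sspan phi ->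
  connect F x y.
Proof.
move=> cphi.
have e i j : i < 10 -> j \in nb i -> connect F (phi i) (phi j).
  by move=> *; apply/connect1/chart_adj.
have c2 i : i < 10 -> connect F (phi 2) (phi i).
  have h1 : connect F (phi 2) (phi 1) by apply: e.
  have h3 : connect F (phi 2) (phi 3) by apply: e.
  have h7 : connect F (phi 2) (phi 7) by apply: e.
  have h6 := connect_trans h7 (e 7 6 isT isT).
  have h8 := connect_trans h7 (e 7 8 isT isT).
  have h0 := connect_trans h1 (e 1 0 isT isT).
  have h4 := connect_trans h3 (e 3 4 isT isT).
  have h5 := connect_trans h6 (e 6 5 isT isT).
  have h9 := connect_trans h8 (e 8 9 isT isT).
  by do 10?[case: i => [|i] //].
move=> /spanP[i lti ->] /spanP[j ltj ->]; apply: connect_trans (c2 _ ltj).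
by rewrite (sym_connect_sym sF) c2.
Qed.

Lemma span_connectE phi x y : chart phi -> x \in sspan phi ->
  connect F x y = (y \in sspan phi).
Proof.
move=> cphi xp; apply/idP/idP; last exact: span_connect xp.
move=> cxy; rewrite -(@closed_connect _ F (sspan phi) _ _ _ cxy) //.
apply: intro_closed; first exact: sym_connect_sym.
by move=> u v uv up; apply: span_closed up uv.
Qed.

(** For a simple [F] and [W = setT] this amounts to [F] being an S-forest. A general [W] allows
    components to be taken away one at a time. *)
Definition charted W :=
  forall x, x \in W -> exists phi, [/\ chart phi, x \in sspan phi & sspan phi
    \subset W].

Lemma charted_diff W phi : charted W -> chart phi -> charted (W :\: sspan phi).
Proof.
move=> cW cphi x /setDP[xW xn]; have [psi [cpsi xp sp]] := cW x xW.
exists psi; split=> //; apply/subsetP => y yp; rewrite inE (subsetP sp) // andbT.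
apply: contra xn => yphi; rewrite -(span_connectE _ cphi yphi).
exact: (span_connect cpsi).
Qed.

Lemma charted_ind (Q : {set T} -> Prop) : Q set0 ->
  (forall phi W, chart phi -> [disjoint sspan phi & W] -> Q W ->
    Q (sspan phi :|: W)) ->
  forall W, charted W -> Q W.
Proof.
move=> Q0 QS W; move: {2}#|W| (leqnn #|W|) => n; elim: n W => [|n IHn] W le cW.
  by rewrite (cards0_eq (_ : #|W| = 0)) //; lia.
have [->//|[x xW]] := set_0Vmem W.
have [phi [cphi xp sp]] := cW x xW.
have -> : W = sspan phi :|: (W :\: sspan phi).
  by rewrite -{1}(setID W (sspan phi)) (setIidPr sp).
apply: QS => //; first by rewrite -setI_eq0 setIDA setIC setDIl setDv setI0.
apply: IHn (charted_diff cW cphi).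
by rewrite cardsD (setIidPr sp) card_span //; lia.
Qed.

Definition relabel (s : seq nat) phi : nat -> T := fun i => phi (nth 0 s i).

(** The permutation is given by the list of its values, so that the test is settled by
    computation. *)
Definition automorphism (s : seq nat) :=
  [&& perm_eq s (iota 0 10) &
      all (fun i => perm_eq [seq nth 0 s j | j <- nb i] (nb (nth 0 s i))) (iota 0
        10)].

Lemma chart_relabel s phi : automorphism s -> chart phi ->
  chart (relabel s phi) /\ sspan (relabel s phi) = sspan phi.
Proof.
case/andP=> ps /allP hs [inj h].
have sz : size s = 10 by rewrite (perm_size ps) size_iota.
have lt i : i < 10 -> nth 0 s i < 10.
  by move=> lti; have := perm_mem ps (nth 0 s i); rewrite mem_iota mem_nth ?sz.
split; last first.
  apply/setP => x; rewrite [LHS]in_set [RHS]in_set -(eq_mem_map phi (perm_mem ps)).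
  by rewrite -{2}(mkseq_nth 0 s) sz /mkseq -map_comp.
split=> [i j ilt jlt /(inj _ _ (lt _ ilt) (lt _ jlt)) E|i z lti].
  have us : uniq s by rewrite (perm_uniq ps) iota_uniq.
  by apply/eqP; rewrite -(nth_uniq 0 _ _ us) ?sz ?E.
rewrite /relabel h ?lt //.
rewrite -(eq_mem_map phi (perm_mem (hs i _))) ?mem_iota //.
by rewrite -map_comp.
Qed.

(** The automorphisms of the spanner are transitive on the [i]-vertices for each [i], so any vertex
    can be given one of the numbers 0, 1, 2; it is then an [r.+1]-vertex. *)
Lemma chart_at phi x : chart phi -> x \in sspan phi ->
  exists psi r, [/\ chart psi, sspan psi = sspan phi, r < 3 & x = psi r].
Proof.
move=> cphi /spanP[i lti ->].
have ex s r : automorphism s -> r < 3 -> nth 0 s r = i ->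
    exists psi r, [/\ chart psi, sspan psi = sspan phi, r < 3 & phi i = psi r].
  move=> hs ltr E; have [c sE] := chart_relabel hs cphi.
  by exists (relabel s phi), r; rewrite /relabel E.
(* The automorphisms used are the reversal of the first side, the interchange of the sides, and an
   interchange combined with a reversal. *)
case: (ltnP i 3) => [i3|i3]; first by exists phi, i.
case: (ltnP i 5) => [i5|i5].
  apply: (ex [:: 4; 3; 2; 1; 0; 5; 6; 7; 8; 9] (4 - i)) => //; first by lia.
  by have [->|->] : i = 3 \/ i = 4 by lia.
case: (ltnP i 8) => [i8|i8].
  apply: (ex [:: 5; 6; 7; 8; 9; 0; 1; 2; 3; 4] (i - 5)) => //; first by lia.
  by have [->|[->|->]] : i = 5 \/ i = 6 \/ i = 7 by lia.
apply: (ex [:: 9; 8; 7; 6; 5; 0; 1; 2; 3; 4] (9 - i)) => //; first by lia.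
by have [->|->] : i = 8 \/ i = 9 by lia.
Qed.

End Charts.

(* Pairs of disjoint matchings are described by vertex-disjoint paths, coloured
   alternately: [path_half b x s] lists the edges of the path [x :: s] in even
   positions if [b], in odd positions otherwise. *)
Fixpoint path_half (b : bool) (x : nat) (s : seq nat) : seq (nat * nat) :=
  if s is y :: s' then
    if b then (x, y) :: path_half false y s' else path_half true y s'
  else [::].

Definition paths_half b (ps : seq (seq nat)) :=
  flatten [seq path_half b (head 0 p) (behead p) | p <- ps].

Definition ends (l : seq (nat * nat)) := flatten [seq [:: p.1; p.2] | p <- l].

Definition paths_in (m : nat) (E : seq (nat * nat)) (ps : seq (seq nat)) : bool :=
  let N := paths_half true ps in
  let N' := paths_half false ps in
  [&& all (gtn m) (ends N), all (gtn m) (ends N'), uniq (ends N), uniq (ends N'),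
      all (fun p => ~~ ((p \in N') || ((p.2, p.1) \in N'))) N &
      all (fun p => (p \in E) || ((p.2, p.1) \in E)) (N ++ N')].

Definition spanner_edges : seq (nat * nat) :=
  [:: (0, 1); (1, 2); (2, 3); (3, 4); (5, 6); (6, 7); (7, 8); (8, 9); (2, 7)].

(** * Pairs of matchings obtained from numbered paths *)

Section Embedding.

Variables (T : finType) (G : rel T).
Hypothesis hG : simple_graph G.
Implicit Types (psi : nat -> T) (K : {set T}).

Definition embed psi (l : seq (nat * nat)) : {set {set T}} :=
  [set d in [seq [set psi p.1; psi p.2] | p <- l]].

Lemma embedP psi l d :
  reflect (exists2 p, p \in l & d = [set psi p.1; psi p.2]) (d \in embed psi l).
Proof. by rewrite in_set; apply: mapP. Qed.

Lemma cover_embed psi l x : x \in cover (embed psi l) ->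
  exists2 i, i \in ends l & x = psi i.
Proof.
case/bigcupP=> d /embedP[p pl ->] /set2P[] ->.
  by exists p.1 => //; apply/flatten_mapP; exists p; rewrite // !inE eqxx.
by exists p.2 => //; apply/flatten_mapP; exists p; rewrite // !inE eqxx orbT.
Qed.

Lemma embed_matching psi m l : {in gtn m &, injective psi} ->
  all (gtn m) (ends l) -> uniq (ends l) ->
  {in l, forall p, G (psi p.1) (psi p.2)} ->
  matching G (embed psi l) /\ #|embed psi l| = size l.
Proof.
move=> inj; elim: l => [|[i j] l IHl] /=.
  move=> _ _ _; have -> : embed psi [::] = set0 by apply/setP => d; rewrite !inE.
  by rewrite matching0 cards0.
case/and3P=> ltm ltj ltl /and3P[ni nj ul] hl.
have [|mM cM] := IHl ltl ul; first by move=> p pl; apply: hl; rewrite inE pl orbT.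
have nc k : k < m -> k \notin ends l -> psi k \notin cover (embed psi l).
  move=> ltk; apply: contra => /cover_embed[k' k'l E].
  by rewrite (inj k k') //; apply: (allP ltl).
rewrite inE negb_or in ni; case/andP: ni => nij ni.
have -> : embed psi ((i, j) :: l) = [set psi i; psi j] |: embed psi l.
  by apply/setP => d; rewrite in_setU1 !in_set /= in_cons.
split; first by apply: matching_add => //; [apply: (hl (i, j));
  rewrite inE eqxx | exact: nc ..].
rewrite cardsU1 cM (_ : _ \notin _) //; apply: contra (nc i ltm ni).
by move=> /adj_cover[].
Qed.

(** Carries a path system that was checked by computation on numbers over to [G]. Injectivity of
    [psi] keeps both halves matchings and keeps them disjoint. *)
Lemma embed_pair psi m E ps : {in gtn m &, injective psi} ->
  {in E, forall p, G (psi p.1) (psi p.2)} -> paths_in m E ps ->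
  exists H H', [/\ (H, H') \in B2 G, #|H| = size (paths_half true ps),
    #|H'| = size (paths_half false ps),
    cover H \subset [set x in map psi (iota 0 m)] &
    cover H' \subset [set x in map psi (iota 0 m)]].
Proof.
move=> inj hE /and5P[ltN ltN' uN uN' /andP[/allP dNN' /allP hN]].
set N := paths_half true ps in ltN uN dNN' hN *.
set N' := paths_half false ps in ltN' uN' dNN' hN *.
have hG' p : p \in N ++ N' -> G (psi p.1) (psi p.2).
  by move=> /hN /orP[/hE //|/hE /=]; rewrite (proj1 hG).
have [|mM cM] := embed_matching inj ltN uN.
  by move=> p pN; apply: hG'; rewrite mem_cat pN.
have [|mM' cM'] := embed_matching inj ltN' uN'.
  by move=> p pN; apply: hG'; rewrite mem_cat pN orbT.
have sub l : all (gtn m) (ends l) ->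
    cover (embed psi l) \subset [set x in map psi (iota 0 m)].
  move=> /allP ltl; apply/subsetP => x /cover_embed[i il ->]; rewrite in_set.
  by apply: map_f; rewrite mem_iota; apply: ltl.
have memE (l : seq (nat * nat)) p : p \in l -> (p.1 \in ends l) * (p.2 \in ends l).
  by move=> pl; split; apply/flatten_mapP; exists p; rewrite // !inE eqxx ?orbT.
exists (embed psi N), (embed psi N'); split; rewrite ?sub //.
apply/pairP; split=> //; apply/pred0P => d /=.
apply/negP => /andP[/embedP[p pN ->] /embedP[q qN]].
have [p1 p2] := memE _ _ pN; have [q1 q2] := memE _ _ qN.
have inj' i j : i \in ends N -> j \in ends N' -> psi i = psi j -> i = j.
  by move=> iN jN; apply: inj; [apply: (allP ltN) | apply: (allP ltN')].
have := dNN' p pN; case: p q {pN hN dNN'} qN p1 p2 q1 q2 => [a b] [a' b'] /= qN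
  p1 p2 q1 q2.
rewrite negb_or => /andP[n1 n2].
case/set2_eqP => -[E1 E2].
  by rewrite (inj' _ _ p1 q1 E1) (inj' _ _ p2 q2 E2) qN in n1.
by rewrite (inj' _ _ p1 q2 E1) (inj' _ _ p2 q1 E2) qN in n2.
Qed.

Lemma pair_union H1 H1' H2 H2' K1 K2 : (H1, H1') \in B2 G -> (H2, H2') \in B2 G ->
  cover H1 \subset K1 -> cover H1' \subset K1 -> cover H2 \subset K2 ->
  cover H2' \subset K2 -> [disjoint K1 & K2] ->
  [/\ (H1 :|: H2, H1' :|: H2') \in B2 G, #|H1 :|: H2| = #|H1| + #|H2| &
      #|H1' :|: H2'| = #|H1'| + #|H2'|].
Proof.
move=> /pairP[m1 m1' d1] /pairP[m2 m2' d2] s1 s1' s2 s2' dK.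
have dis M N : matching G M -> cover M \subset K1 -> cover N \subset K2 ->
  M :&: N = set0.
  move=> mM sM sN; apply/setP => d; rewrite !inE; apply/negP => /andP[dM dN].
  have [x [y [_ E]]] := edgeP (matching_edge mM dM).
  rewrite E in dM dN; have xM := (adj_cover dM).1; have xN := (adj_cover dN).1.
  by have /pred0P/(_ x) := dK; rewrite /= (subsetP sM _ xM) (subsetP sN _ xN).
split; last 2 first.
- by rewrite cardsU dis // cards0 subn0.
- by rewrite cardsU dis // cards0 subn0.
apply/pairP; split.
- by apply: matching_union => //; apply: disjointWl s1 (disjointWr s2 dK).
- by apply: matching_union => //; apply: disjointWl s1' (disjointWr s2' dK).
rewrite -setI_eq0 !setIUl !setIUr (dis H1 H2') // [H2 :&: H1']setIC (dis H1' H2) //.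
by move: d1 d2; rewrite -!setI_eq0 => /eqP-> /eqP->; rewrite !setU0.
Qed.

Variable F : rel T.
Hypotheses (sF : symmetric F) (sub : subrel F G).

Lemma chart_spanner_edges phi : chart F phi ->
  {in spanner_edges, forall p, G (phi p.1) (phi p.2)}.
Proof.
move=> cphi p pE.
have /allP/(_ p pE)/andP[lt1 nb1] : all (fun p => (p.1 < 10) && (p.2 \in nb p.1))
  spanner_edges by [].
exact/sub/(chart_adj cphi).
Qed.

Lemma charted_pair W : charted F W -> exists H H',
  [/\ (H, H') \in B2 G, cover H \subset W, cover H' \subset W,
      #|H| * 5 = #|W| * 2 & #|H'| * 5 = #|W| * 2].
Proof.
move=> cW; pattern W; apply: (charted_ind sF _ _ cW) => {W cW}.
  exists set0, set0; rewrite cover0 !cards0; split=> //.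
  by apply/pairP; split; rewrite ?matching0 // -setI_eq0 setI0.
move=> phi W' cphi dis [H [H' [pP sH sH' cH cH']]].
(* The two sides have four edges each; coloured alternately they give four edges to each
   matching. *)
have [||N [N' [pN cN cN' sN sN']]] := @embed_pair phi 10 spanner_edges
  [:: [:: 0; 1; 2; 3; 4]; [:: 5; 6; 7; 8; 9]] cphi.1 => //.
  exact: chart_spanner_edges.
have [pU cU cU'] := pair_union pN pP sN sN' sH sH' dis.
have cW : #|sspan phi :|: W'| = 10 + #|W'|.
  by rewrite cardsU (card_span cphi) (eqP (_ : _ :&: W' == set0)) ?setI_eq0 //
    cards0 subn0.
have {}cN : #|N| = 4 := cN; have {}cN' : #|N'| = 4 := cN'.
exists (N :|: H), (N' :|: H'); split=> //.
- by rewrite /cover bigcup_setU setUSS.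
- by rewrite /cover bigcup_setU setUSS.
- by rewrite cU cW; lia.
- by rewrite cU' cW; lia.
Qed.

Lemma charted_matching W : charted F W -> exists M,
  [/\ matching G M, cover M \subset W & #|M| * 2 = #|W|].
Proof.
move=> cW; pattern W; apply: (charted_ind sF _ _ cW) => {W cW}.
  by exists set0; rewrite cover0 !cards0 matching0.
move=> phi W' cphi dis [M [mM sM cM]].
(* The perfect matching of a spanner: the four edges of [U] and the edge joining the 3-vertices. *)
have [||N [N' [/pairP[mN _ _] cN _ sN _]]] := @embed_pair phi 10 spanner_edges
  [:: [:: 0; 1]; [:: 2; 7]; [:: 3; 4]; [:: 5; 6]; [:: 8; 9]] cphi.1 => //.
  exact: chart_spanner_edges.
have dNM : [disjoint cover N & cover M] by apply: disjointWl sN (disjointWr sM dis).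
have mU := matching_union mN mM dNM.
exists (N :|: M); split=> //; first by rewrite /cover bigcup_setU setUSS.
rewrite -(card_cover hG mU) /cover bigcup_setU !cardsU -!/(cover _).
rewrite (card_cover hG mN) (card_cover hG mM) cN cM (card_span cphi).
rewrite (eqP (_ : _ :&: W' == set0)) ?setI_eq0 //.
by rewrite (eqP (_ : cover N :&: cover M == set0)) ?setI_eq0 // !cards0.
Qed.

(** Completing the pair by the sides of the spanners in [R] gives at least [2 * alpha G], hence at
    least [lambda G], edges in total, while the first matching has more than [alpha G]. *)
Lemma charted_optimal (W R K : {set T}) N N' c : alpha G * 5 = #|W| * 2 ->
  charted F R ->
  [disjoint K & R] -> (N, N') \in B2 G -> cover N \subset K -> cover N' \subset K ->
  #|W| = #|R| + 10 * c -> 8 * c <= #|N| + #|N'| -> 4 * c < #|N| -> False.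
Proof.
move=> aE cR dis pN sN sN' cW le lt.
have [H [H' [pP sH sH' cH cH']]] := charted_pair cR.
have [pU cU cU'] := pair_union pN pP sN sN' sH sH' dis.
have := pair_le_alpha pU; have := lambda_le G; lia.
Qed.

End Embedding.

(* [c] spanners contribute a pair of matchings with [4 * c] edges each, which is
   beaten as soon as as many edges form paths some of which have odd length. *)
Definition paths_beat (m c : nat) (E : seq (nat * nat)) (ps : seq (seq nat)) :
  bool :=
  [&& paths_in m E ps,
      8 * c <= size (paths_half true ps) + size (paths_half false ps) &
      4 * c < size (paths_half true ps)].

(** * Edges excluded by the optimality of the sides *)

Section LocalOptimality.

Variables (T : finType) (G F : rel T) (W : {set T}).
Hypotheses (hG : simple_graph G) (sF : symmetric F) (sub : subrel F G).
Hypotheses (cW : charted F W) (aE : alpha G * 5 = #|W| * 2).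
Implicit Types (phi psi : nat -> T) (ps : seq (seq nat)) (X E : seq (nat * nat)).

Lemma paths_beat_absurd psi m c E ps R : {in gtn m &, injective psi} ->
  {in E, forall p, G (psi p.1) (psi p.2)} -> charted F R ->
  [disjoint [set x in map psi (iota 0 m)] & R] -> #|W| = #|R| + 10 * c ->
  paths_beat m c E ps -> False.
Proof.
move=> inj hE cR dis cWR /and3P[hps le lt].
have [N [N' [pN cN cN' sN sN']]] := embed_pair hG inj hE hps.
by apply: (charted_optimal hG sF sub aE cR dis pN sN sN' cWR); rewrite cN ?cN'.
Qed.

Lemma card_diff_span (R : {set T}) phi : chart F phi -> sspan phi \subset R ->
  #|R| = #|R :\: sspan phi| + 10.
Proof.
move=> cphi sp; rewrite cardsD (setIidPr sp) (card_span cphi).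
by have := subset_leq_card sp; rewrite (card_span cphi); lia.
Qed.

Lemma spanner_optimal phi X ps : chart F phi -> sspan phi \subset W ->
  {in X, forall p, G (phi p.1) (phi p.2)} ->
  paths_beat 10 1 (spanner_edges ++ X) ps -> False.
Proof.
move=> cphi sp hX; apply: (paths_beat_absurd (psi := phi) (R := W :\: sspan phi)).
- exact: cphi.1.
- by move=> p; rewrite mem_cat => /orP[/(chart_spanner_edges sub cphi)|/hX].
- exact: charted_diff.
- by rewrite -setI_eq0 setIDA setIC setDIl setDv setI0.
- exact: card_diff_span.
Qed.

Definition add_vertex phi (z : T) i := if i < 10 then phi i else z.

(** The vertex [z], numbered 10, lies outside [W]: the paths may use it although only one spanner is
    given up. *)
Lemma spanner_vertex_optimal phi z X ps : chart F phi -> sspan phi \subset W ->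
  z \notin W -> {in X, forall p, G (add_vertex phi z p.1) (add_vertex phi z p.2)} ->
  paths_beat 11 1 (spanner_edges ++ X) ps -> False.
Proof.
move=> cphi sp zW hX.
have zphi i : i < 10 -> phi i <> z.
  by move=> lti E; rewrite -E (subsetP sp) ?mem_span in zW.
apply: (paths_beat_absurd (psi := add_vertex phi z) (R := W :\: sspan phi)).
- move=> i j; rewrite !unfold_in /= /add_vertex => lti ltj.
  case: ltnP => [i10|i10]; case: ltnP => [j10|j10].
  + exact: cphi.1.
  + by move/zphi.
  + by move/esym/zphi.
  + by lia.
- move=> p; rewrite mem_cat => /orP[pE|/hX //].
  have /allP/(_ p pE)/andP[lt1 lt2] : all (fun p => (p.1 < 10) && (p.2 < 10))
    spanner_edges by [].
  by rewrite /add_vertex lt1 lt2; apply: (chart_spanner_edges sub cphi).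
- exact: charted_diff.
- rewrite disjoint_subset; apply/subsetP => x; rewrite in_set => /mapP[i _ ->].
  apply/negP => /setDP[]; rewrite /add_vertex; case: ltnP => [lti _|_].
    by rewrite mem_span.
  by rewrite (negPf zW).
- exact: card_diff_span.
Qed.

Definition add_chart phi psi i : T := if i < 10 then phi i else psi (i - 10).

Lemma add_chartD phi psi i : add_chart phi psi (i + 10) = psi i.
Proof. by rewrite /add_chart ltnNge leq_addl addnK. Qed.

Definition shift_edges := [seq (p.1 + 10, p.2 + 10) | p <- spanner_edges].

(** Handles an edge between two components; the numbers from 10 on belong to [psi]. *)
Lemma two_spanners_optimal phi psi X ps : chart F phi -> sspan phi \subset W ->
  chart F psi -> sspan psi \subset W :\: sspan phi ->
  {in X, forall p, G (add_chart phi psi p.1) (add_chart phi psi p.2)} ->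
  paths_beat 20 2 (spanner_edges ++ shift_edges ++ X) ps -> False.
Proof.
move=> cphi sp cpsi sp' hX.
have dis i j : i < 10 -> j < 10 -> phi i <> psi j.
  move=> lti ltj E; have := subsetP sp' _ (mem_span psi ltj).
  by rewrite inE -E mem_span.
apply: (paths_beat_absurd (psi := add_chart phi psi)
                          (R := (W :\: sspan phi) :\: sspan psi)).
- move=> i j; rewrite !unfold_in /= /add_chart => lti ltj.
  case: ltnP => [i10|i10]; case: ltnP => [j10|j10].
  + exact: cphi.1.
  + by move/dis => []; lia.
  + by move/esym/dis => []; lia.
  + by move/cpsi.1; rewrite !unfold_in /=; lia.
- move=> p; rewrite !mem_cat => /or3P[pE|/mapP[q qE ->]|/hX //].
    have /allP/(_ p pE)/andP[lt1 lt2] : all (fun p => (p.1 < 10) && (p.2 < 10))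
      spanner_edges by [].
    by rewrite /add_chart lt1 lt2; apply: (chart_spanner_edges sub cphi).
  rewrite !add_chartD; exact: (chart_spanner_edges sub cpsi).
- by apply: charted_diff => //; apply: charted_diff.
- rewrite disjoint_subset; apply/subsetP => x; rewrite in_set => /mapP[i + ->].
  rewrite mem_iota => lti; apply/negP => /setDP[/setDP[_]].
  rewrite /add_chart; case: ltnP => [i10|i10]; first by rewrite mem_span.
  by rewrite mem_span //; lia.
- by rewrite (card_diff_span cphi sp) (card_diff_span cpsi sp') -addnA.
Qed.

Lemma charted_at x : x \in W -> exists phi r,
  [/\ chart F phi, sspan phi \subset W, r < 3 & x = phi r].
Proof.
move=> xW; have [phi [cphi xp sp]] := cW xW.
by have [psi [r [cpsi E ltr ->]]] := chart_at cphi xp; exists psi, r; rewrite E.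
Qed.

(** According to the type of [y], the edge to [z] is used in one of three path systems with at least
    eight edges in all, more than four of them in the first matching. *)
Lemma charted_no_exit z y : z \notin W -> y \in W -> ~~ G z y.
Proof.
move=> zW yW; apply/negP => Gzy; have [phi [r [cphi sp ltr E]]] := charted_at yW.
have hX : {in [:: (10, r)], forall p, G (add_vertex phi z p.1) (add_vertex phi z
  p.2)}.
  by move=> p; rewrite inE => /eqP-> /=; rewrite /add_vertex (ltn_trans ltr) // -E.
have opt := spanner_vertex_optimal cphi sp zW hX.
case: r ltr {E hX} opt => [|[|[|//]]] _ opt.
- exact: (opt [:: [:: 10; 0; 1; 2; 3; 4]; [:: 5; 6; 7; 8; 9]]).
- exact: (opt [:: [:: 0; 1; 10]; [:: 4; 3; 2; 7; 8; 9]; [:: 5; 6]]).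
- exact: (opt [:: [:: 10; 2; 3; 4]; [:: 0; 1]; [:: 5; 6; 7; 8; 9]]).
Qed.

Lemma charted_away phi x : chart F phi -> x \in W -> x \notin sspan phi ->
  exists psi r, [/\ chart F psi, sspan psi \subset W :\: sspan phi, r < 3 & x =
    psi r].
Proof.
move=> cphi xW xn; have [|psi [cpsi xp sp]] := charted_diff sF cW cphi (x := x).
  by rewrite inE xn.
by have [psi' [r [cpsi' E ltr ->]]] := chart_at cpsi xp; exists psi', r; rewrite E.
Qed.

(** This is condition (a). Every other neighbour of a 1-vertex is refuted by an explicit better path
    system: case by case inside the spanner, and by the type of [x] if [x] lies in another one. *)
Lemma nbr_of_end phi x : chart F phi -> sspan phi \subset W -> x \in W ->
  G (phi 0) x -> x = phi 1 \/ x = phi 2.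
Proof.
move=> cphi sp xW Gx; have [/spanP[j ltj E]|xn] := boolP (x \in sspan phi).
  have hX : {in [:: (0, j)], forall p, G (phi p.1) (phi p.2)}.
    by move=> p; rewrite inE => /eqP->; rewrite -E.
  have opt := spanner_optimal cphi sp hX; rewrite E; rewrite {}E in Gx.
  move=> {hX}; do 10?[case: j ltj Gx opt => [|j] ltj Gx opt] => //.
  - by case: (hG) => _ irr; rewrite irr in Gx.
  - by left.
  - by right.
  - by case: (opt [:: [:: 4; 3; 0; 1; 2; 7; 8; 9]; [:: 5; 6]]).
  - by case: (opt [:: [:: 1; 0; 4; 3; 2; 7; 8; 9]; [:: 5; 6]]).
  - by case: (opt [:: [:: 4; 3; 2; 1; 0; 5; 6; 7; 8; 9]]).
  - by case: (opt [:: [:: 5; 6; 0; 1]; [:: 4; 3; 2; 7; 8; 9]]).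
  - by case: (opt [:: [:: 4; 3; 2; 1; 0; 7; 8; 9]; [:: 5; 6]]).
  - by case: (opt [:: [:: 9; 8; 0; 1]; [:: 4; 3; 2; 7; 6; 5]]).
  - by case: (opt [:: [:: 4; 3; 2; 1; 0; 9; 8; 7; 6; 5]]).
have [psi [r [cpsi sp' ltr E]]] := charted_away cphi xW xn.
have hX : {in [:: (0, r + 10)],
    forall p, G (add_chart phi psi p.1) (add_chart phi psi p.2)}.
  by move=> p; rewrite inE => /eqP->; rewrite add_chartD -E.
have opt := two_spanners_optimal cphi sp cpsi sp' hX.
case: r ltr {E hX} opt => [|[|[|//]]] _ opt; exfalso.
- exact: (opt [:: [:: 4; 3; 2; 1; 0; 10; 11; 12; 13; 14]; [:: 15; 16; 17; 18; 19];
                  [:: 5; 6; 7; 8; 9]]).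
- exact: (opt [:: [:: 4; 3; 2; 1; 0; 11; 10]; [:: 14; 13; 12; 17; 18; 19];
  [:: 15; 16];
                  [:: 5; 6; 7; 8; 9]]).
- exact: (opt [:: [:: 4; 3; 2; 1; 0; 12; 13; 14]; [:: 10; 11]; [:: 15; 16; 17;
  18; 19];
                  [:: 5; 6; 7; 8; 9]]).
Qed.

(** This is condition (b). Because of the triangle on 0, 1, 2, the side can also be run through as
    4, 3, 2, 0, 1; then [phi 1] is an end, and the path systems for an end apply with 0 and 1
    interchanged. *)
Lemma nbr_of_middle phi x : chart F phi -> sspan phi \subset W -> x \in W ->
  G (phi 0) (phi 2) -> G (phi 1) x -> x = phi 0 \/ x = phi 2.
Proof.
move=> cphi sp xW G02 Gx; have [/spanP[j ltj E]|xn] := boolP (x \in sspan phi).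
  have hX : {in [:: (0, 2); (1, j)], forall p, G (phi p.1) (phi p.2)}.
    by move=> p; rewrite !inE => /orP[]/eqP->; rewrite // -E.
  have opt := spanner_optimal cphi sp hX; rewrite E; rewrite {}E in Gx.
  move=> {hX}; do 10?[case: j ltj Gx opt => [|j] ltj Gx opt] => //.
  - by left.
  - by case: (hG) => _ irr; rewrite irr in Gx.
  - by right.
  - by case: (opt [:: [:: 4; 3; 1; 0; 2; 7; 8; 9]; [:: 5; 6]]).
  - by case: (opt [:: [:: 3; 4; 1; 0; 2; 7; 8; 9]; [:: 5; 6]]).
  - by case: (opt [:: [:: 4; 3; 2; 0; 1; 5; 6; 7; 8; 9]]).
  - by case: (opt [:: [:: 0; 1; 6; 5]; [:: 4; 3; 2; 7; 8; 9]]).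
  - by case: (opt [:: [:: 4; 3; 2; 0; 1; 7; 8; 9]; [:: 5; 6]]).
  - by case: (opt [:: [:: 0; 1; 8; 9]; [:: 4; 3; 2; 7; 6; 5]]).
  - by case: (opt [:: [:: 4; 3; 2; 0; 1; 9; 8; 7; 6; 5]]).
have [psi [r [cpsi sp' ltr E]]] := charted_away cphi xW xn.
have hX : {in [:: (0, 2); (1, r + 10)],
    forall p, G (add_chart phi psi p.1) (add_chart phi psi p.2)}.
  move=> p; rewrite !inE => /orP[]/eqP-> //.
  by rewrite add_chartD -E.
have opt := two_spanners_optimal cphi sp cpsi sp' hX.
case: r ltr {E hX} opt => [|[|[|//]]] _ opt; exfalso.
- exact: (opt [:: [:: 4; 3; 2; 0; 1; 10; 11; 12; 13; 14]; [:: 15; 16; 17; 18; 19];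
                  [:: 5; 6; 7; 8; 9]]).
- exact: (opt [:: [:: 4; 3; 2; 0; 1; 11; 10]; [:: 14; 13; 12; 17; 18; 19];
  [:: 15; 16];
                  [:: 5; 6; 7; 8; 9]]).
- exact: (opt [:: [:: 4; 3; 2; 0; 1; 12; 13; 14]; [:: 10; 11]; [:: 15; 16; 17;
  18; 19];
                  [:: 5; 6; 7; 8; 9]]).
Qed.

End LocalOptimality.

(** Choosing a member of [S] inside each of the disjoint sets [K x] is injective, and it is
    bijective as soon as [S] is no larger than [X]. *)
Lemma disjoint_choice (T : finType) (X : {set T}) (K : T ->
  {set T}) (S : {set {set T}}) :
  (forall x x' v, x \in X -> x' \in X -> v \in K x -> v \in K x' -> x = x') ->
  set0 \notin S -> (forall x, x \in X -> exists2 d, d \in S & d \subset K x) ->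
  #|X| <= #|S| /\ (#|S| <= #|X| ->
    (forall d, d \in S -> exists2 x, x \in X & d \subset K x) /\
    (forall x d d', x \in X -> d \in S -> d' \in S -> d \subset K x ->
       d' \subset K x -> d = d')).
Proof.
move=> dK S0 hS.
pose f x := odflt set0 [pick d in S | d \subset K x].
have fP x : x \in X -> f x \in S /\ f x \subset K x.
  move=> xX; rewrite /f; case: pickP => [d /andP[]//|/= no].
  by have [d dS dKx] := hS x xX; have := no d; rewrite dS dKx.
have uniqK d x x' : d \in S -> x \in X -> x' \in X -> d \subset K x ->
  d \subset K x' -> x = x'.
  move=> dS xX xX' sd sd'; have /set0Pn[v vd] : d != set0
    by apply: contraNneq S0 => <-.
  by apply: (dK _ _ v) => //; [apply: (subsetP sd) | apply: (subsetP sd')].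
have injf : {in X &, injective f}.
  move=> x x' xX xX' E; have [fS fK] := fP x xX; have [_ fK'] := fP x' xX'.
  by apply: (uniqK (f x)) => //; rewrite E.
have sub : f @: X \subset S by apply/subsetP => d /imsetP[x /fP[h _] ->].
have cf : #|f @: X| = #|X| by apply: card_in_imset.
split=> [|le]; first by rewrite -cf subset_leq_card.
have fE : f @: X = S by apply/eqP; rewrite eqEcard sub cf.
have surj d : d \in S -> exists2 x, x \in X & d = f x.
  by rewrite -fE => /imsetP[x xX ->]; exists x.
split=> [d /surj[x xX ->]|x d d' xX /[dup] dS /surj[y yX E] /[dup] dS' /surj[y'
  yX' E'] sd sd'].
  by exists x => //; case: (fP x xX).
have xy : x = y by apply: (uniqK d) => //; rewrite E; case: (fP y yX).
have xy' : x = y' by apply: (uniqK d') => //; rewrite E'; case: (fP y' yX').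
by rewrite E E' -xy -xy'.
Qed.

(** * The structure of an extremal pair relative to a maximum matching *)

Section Extremal.

Variables (T : finType) (G : rel T) (M H H' : {set {set T}}).
Hypothesis hG : simple_graph G.
Hypotheses (mM : matching G M) (cM : #|M| = beta G).
Hypotheses (pP : (H, H') \in B2 G) (sE : #|H| + #|H'| = lambda G) (aH : #|H| =
  alpha G).
Hypothesis ext : forall H1 H1', (H1, H1') \in B2 G ->
  #|H1| + #|H1'| = lambda G -> #|H1| = alpha G -> #|M :&: H1| <= #|M :&: H|.
Implicit Types (x y z u v w : T) (d : {set T}) (K : {set T}).

Let mH : matching G H. Proof. by case/pairP: pP. Qed.
Let mH' : matching G H'. Proof. by case/pairP: pP. Qed.
Let D := H :|: H'.

Let X := cover M :\: cover H.
Let comp x := [set v | connect (adj D) x v].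

(** Otherwise the edge could enter [H]. If [H] misses [y], the total exceeds [lambda G]; if not, the
    edge replaces the [H]-edge at [y], which is not in [M], and [H] gains an edge in common with
    [M]. *)
Lemma ext_mate x y : x \in X -> [set x; y] \in M -> [set x; y] \in H'.
Proof.
case/setDP=> xM xH Mxy; apply: contraT => nd'.
have Gxy := matching_adj hG mM Mxy.
have nd : [set x; y] \notin H by apply: contra xH => /adj_cover[].
have [yH|yH] := boolP (y \in cover H); last first.
  have := pair_le_lambda (pair_add hG pP Gxy nd' xH yH).
  by rewrite cardsU1 nd add1n addSn sE ltnn.
have [z Hyz] := mate hG mH yH; set e := [set y; z] in Hyz.
have pD : (H :\ e, H') \in B2 G by apply: pair_sub pP _ _; rewrite ?subD1set.
have xD : x \notin cover (H :\ e) by apply: contra xH;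
  apply/subsetP/coverS/subD1set.
have yD : y \notin cover (H :\ e) by apply: cover_del mH Hyz _; rewrite set21.
have ndD : [set x; y] \notin H :\ e by rewrite inE (negPf nd) andbF.
have c1 : #|[set x; y] |: (H :\ e)| = #|H|.
  by rewrite cardsU1 ndD (cardsD1 e H) Hyz.
have eM : e \notin M.
  apply: contra xH => eM; rewrite (mate_uniq mM (_ : [set y; x] \in M) eM).
    by case: (adj_cover Hyz).
  by rewrite setUC.
have := ext (pair_add hG pD Gxy nd' xD yD); rewrite c1 => /(_ sE aH).
suff -> : M :&: ([set x; y] |: (H :\ e)) = [set x; y] |: (M :&: H).
  by rewrite cardsU1 in_setI (negPf nd) andbF add1n ltnn.
apply/setP => d; rewrite !inE; case: (eqVneq d [set x; y]) => [->|_] /=;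
  first by rewrite Mxy.
by case: (eqVneq d e) => [->|//]; rewrite (negPf eM).
Qed.

(** If [H] missed both ends, moving the edge from [H'] to [H] would keep the total and make [H]
    larger than [alpha G]. *)
Lemma ext_mate_cover x y : x \in X -> [set x; y] \in M -> y \in cover H.
Proof.
move=> xX Mxy; have dH' := ext_mate xX Mxy; case/setDP: xX => xM xH.
apply: contraT => yH; set d := [set x; y] in Mxy dH'.
have nd : d \notin H by apply: contra xH => /adj_cover[].
have pD : (H, H' :\ d) \in B2 G by apply: pair_sub pP _ _; rewrite ?subD1set.
have ndD : d \notin H' :\ d by rewrite in_setD1 eqxx.
have := pair_le_alpha (pair_add hG pD (matching_adj hG mM Mxy) ndD xH yH).
rewrite cardsU1 nd add1n aH addSn -addnS -aH.
by have := cardsD1 d H'; rewrite dH' add1n => <-; rewrite sE ltnn => /(_ (leqnn _)).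
Qed.

Lemma ext_closed K : closed (adj D) K -> #|restr H' K| <= #|restr H K|.
Proof.
move=> clK; have := pair_le_alpha (swapped_pair hG pP clK).
have := swap_card K pP; have := swap_card K (pair_sym pP); lia.
Qed.

(** With equal numbers of edges inside [K], the exchange on [K] gives another optimal pair, and the
    extremal choice of [H] with respect to [M] applies to it. *)
Lemma ext_closed_eq K : closed (adj D) K -> #|restr H' K| = #|restr H K| ->
  #|M :&: restr H' K| <= #|M :&: restr H K|.
Proof.
move=> clK E; have := ext (swapped_pair hG pP clK).
have := swap_card K pP; have := swap_card K (pair_sym pP).
have pM : (M :&: H, M :&: H') \in B2 G by apply: pair_sub pP _ _; rewrite subsetIr.
have rE (N : {set {set T}}) : restr (M :&: N) K = M :&: restr N K.
  by apply/setP => d; rewrite !inE andbA.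
have sME : M :&: swap K H H' = swap K (M :&: H) (M :&: H').
  by apply/setP => d; rewrite !inE; case: (d \in M); rewrite ?andbF.
have := swap_card K pM; rewrite -sME !rE; lia.
Qed.

Lemma comp_closed x : closed (adj D) (comp x).
Proof. by move=> u v uv; rewrite !inE; apply: connect_adj_r. Qed.

Lemma comp_refl x : x \in comp x.
Proof. by rewrite inE connect0. Qed.

Lemma comp_adj x u v : [set u; v] \in D -> u \in comp x -> v \in comp x.
Proof. by move=> uv; rewrite (comp_closed x uv). Qed.

(* In a 2-colouring of the component, [H] covers the class of [x] except [x], and
   [H'] covers the other class; so [H] cannot have more edges than [H'] there. *)
Lemma ext_comp x : x \notin cover H ->
  #|restr H' (comp x)| = #|restr H (comp x)| /\
  (forall v, v \in comp x -> v != x -> v \in cover H).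
Proof.
move=> xH; have [c cD] := two_matchings_bipartite hG mH mH'.
have cov v : v \in comp x -> v != x -> v \in cover (if c v == c x then H else H').
  by rewrite inE => cv; exact: (connect_cover mH mH' cD xH cv).
have col (N : {set {set T}}) : N \subset D -> coloring c (restr N (comp x)).
  by move=> sN u v /(subsetP (restr_sub _ _))/(subsetP sN); apply: cD.
have mr (N : {set {set T}}) : matching G N -> matching G (restr N (comp x)).
  exact/matching_sub/restr_sub.
have covr (N : {set {set T}}) v : N \subset D ->
  (v \in cover (restr N (comp x))) = (v \in comp x) && (v \in cover N).
  move=> sN; have [vK|vK] := boolP (v \in comp x).
    exact: (cover_restr_closed hG pP (@comp_closed x) sN).
  by apply: contraNF vK => /cover_restr.
have sH : H \subset D := subsetUl _ _; have sH' : H' \subset D := subsetUr _ _.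
(* [A] is the class opposite to [x]. All of it is covered by [H'], so [H'] has [#|A|] edges in the
   component, whereas [H] has one for each vertex of [A] it covers; [ext_closed] then makes [H]
   cover all of [A]. *)
set A := [set v in comp x | c v == ~~ c x].
have cH' : #|restr H' (comp x)| = #|A|.
  rewrite (card_color hG (~~ c x) (mr _ mH') (col _ sH')); apply: eq_card => v.
  rewrite [LHS]in_set [RHS]in_set covr //; case cv: (c v == ~~ c x);
    rewrite ?andbF ?andbT //.
  case: (boolP (v \in comp x)) => //= vK; have := cov v vK.
  have -> : (c v == c x) = false by move: cv; case: (c v); case: (c x).
  by apply; apply: contraTneq cv => ->; case: (c x).
have cH := card_color hG (~~ c x) (mr _ mH) (col _ sH).
set A1 := [set v in _ | _] in cH.
have sA : A1 \subset A.
  by apply/subsetP => v /setIdP[]; rewrite covr // => /andP[vK _] cv; apply/setIdP.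
have le := ext_closed (@comp_closed x).
have AE : A1 = A by apply/eqP; rewrite eqEcard sA -cH -cH'.
split; first by rewrite cH' cH AE.
move=> v vK vx; have := cov v vK vx; case: eqVneq => // cv _.
have : v \in A1 by rewrite AE; apply/setIdP; split=> //; move: cv; case: (c v);
  case: (c x).
by case/setIdP; rewrite covr // => /andP[].
Qed.

(** A component containing both [x] and [x'] would have two vertices missed by [H], against
    [ext_comp]. *)
Lemma comp_inj x x' v : x \in X -> x' \in X -> v \in comp x -> v \in comp x' ->
  x = x'.
Proof.
move=> /setDP[_ xH] /setDP[_ xH'] vx vx'; apply/eqP; apply: contraT => ne.
have [_ h] := ext_comp xH'; have := h x; rewrite (negPf xH) ne => -> //.
rewrite !inE in vx vx' *; apply: connect_trans vx' _.
by rewrite connect_adj_sym.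
Qed.

(** The [M]-edge at [x] is an edge of [H'] in the component. Since [H] and [H'] have equally many
    edges there, [ext_closed_eq] forces [H] to share one with [M] as well. *)
Lemma ext_comp_MH x : x \in X -> exists2 d, d \in M :&: H & d \subset comp x.
Proof.
move=> xX; have [xM xH] := setDP xX; have [y Mxy] := mate hG mM xM.
have dH' := ext_mate xX Mxy; have [E _] := ext_comp xH.
have := ext_closed_eq (@comp_closed x) E.
have : [set x; y] \in M :&: restr H' (comp x).
  rewrite !in_set Mxy dH' subUset !sub1set comp_refl (@comp_adj x x y) ?comp_refl
    //.
  by rewrite in_setU dH' orbT.
move=> h; have : 0 < #|M :&: restr H' (comp x)| by apply/card_gt0P;
  exists [set x; y].
move=> h1 /(leq_trans h1)/card_gt0P[d]; rewrite !in_set => /and3P[dM dH sd].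
by exists d; rewrite // in_set dM.
Qed.

(** The [H]-edge at the [M]-mate of [x] serves: if it were in [M], it would end at [x], which [H]
    misses. *)
Lemma ext_comp_HM x : x \in X -> exists2 d, d \in H :\: M & d \subset comp x.
Proof.
move=> xX; have [xM xH] := setDP xX; have [y Mxy] := mate hG mM xM.
have dH' := ext_mate xX Mxy; have [z Hyz] := mate hG mH (ext_mate_cover xX Mxy).
exists [set y; z].
  rewrite in_set Hyz andbT; apply: contra xH => Myz.
  rewrite (mate_uniq mM (_ : [set y; x] \in M) Myz) 1?setUC //.
  by case: (adj_cover Hyz).
have yK : y \in comp x.
  by apply: (@comp_adj x x); rewrite ?comp_refl // in_setU dH' orbT.
by rewrite subUset !sub1set yK (@comp_adj x y) // in_setU Hyz.
Qed.

Hypothesis ratio : beta G * 4 = alpha G * 5.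

(** The components supply [#|X|] edges of [H] inside [M] and as many outside, so [2 * #|X|] is at
    most [alpha G], while [#|X|] is at least twice [beta G - alpha G]. At ratio 5/4 these bounds
    meet. *)
Lemma ext_tight : [/\ cover H \subset cover M, #|M :&: H| = #|X| & #|H :\: M| =
  #|X|].
Proof.
have S0 (N : {set {set T}}) : N \subset H -> set0 \notin N.
  move=> sN; apply/negP => /(subsetP sN)/(matching_edge mH)/(edge_neq0 hG).
  by rewrite eqxx.
have [le1 _] := disjoint_choice comp_inj (S0 _ (subsetIr M H)) ext_comp_MH.
have [le2 _] := disjoint_choice comp_inj (S0 _ (subsetDl H M)) ext_comp_HM.
have c1 := card_cover hG mM; have c2 := card_cover hG mH.
have c3 := cardsID M H; rewrite setIC in c3.
have c4 := cardsID (cover H) (cover M); have c5 := cardsID (cover M) (cover H).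
rewrite setIC in c5; rewrite -/X in c4.
have Y0 : #|cover H :\: cover M| = 0 by lia.
by split; [rewrite -setD_eq0 (cards0_eq Y0) | lia | lia].
Qed.

Lemma ext_tight_MH : (forall d, d \in M :&: H ->
  exists2 x, x \in X & d \subset comp x) /\
  (forall x d d', x \in X -> d \in M :&: H -> d' \in M :&: H -> d \subset comp x ->
     d' \subset comp x -> d = d').
Proof.
have [_ E _] := ext_tight.
have [|_ h] := disjoint_choice comp_inj _ ext_comp_MH; last by apply: h; rewrite E.
by apply/negP => /setIP[_ /(matching_edge mH)/(edge_neq0 hG)]; rewrite eqxx.
Qed.

Lemma ext_tight_HM : (forall d, d \in H :\: M ->
  exists2 x, x \in X & d \subset comp x) /\
  (forall x d d', x \in X -> d \in H :\: M -> d' \in H :\: M -> d \subset comp x ->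
     d' \subset comp x -> d = d').
Proof.
have [_ _ E] := ext_tight.
have [|_ h] := disjoint_choice comp_inj _ ext_comp_HM; last by apply: h; rewrite E.
by apply/negP => /setDP[/(matching_edge mH)/(edge_neq0 hG)]; rewrite eqxx.
Qed.

(** Exactly two edges of [H] lie in the component, one in [M] and one outside, and they cover
    everything but [x]. *)
Lemma card_comp x : x \in X -> #|comp x| = 5.
Proof.
move=> xX; have [xM xH] := setDP xX; have [_ cov] := ext_comp xH.
have one (S : {set {set T}}) : (exists2 d, d \in S & d \subset comp x) ->
    (forall d d', d \in S -> d' \in S -> d \subset comp x -> d' \subset comp x ->
      d = d') ->
    #|restr S (comp x)| = 1.
  move=> [d dS sd] un; apply/eqP/cards1P; exists d; apply/setP => d'; rewrite !inE.
  apply/andP/eqP => [[d'S sd']|->] //; exact: un.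
have c1 := one _ (ext_comp_MH xX) (fun d d' => ext_tight_MH.2 x d d' xX).
have c2 := one _ (ext_comp_HM xX) (fun d d' => ext_tight_HM.2 x d d' xX).
have c3 := cardsID M (restr H (comp x)).
rewrite (_ : restr H _ :&: M = restr (M :&: H) (comp x)) in c3; last first.
  by apply/setP => d; rewrite !in_set andbC andbA.
rewrite (_ : restr H _ :\: M = restr (H :\: M) (comp x)) in c3; last first.
  by apply/setP => d; rewrite !in_set andbA.
have c4 := card_cover hG (matching_sub (restr_sub H (comp x)) mH).
have -> : comp x = x |: cover (restr H (comp x)).
  apply/setP => v; rewrite in_setU1; case: eqVneq => [->|vx];
    first by rewrite comp_refl.
  apply/idP/idP => [vK|/cover_restr //].
  by rewrite (cover_restr_closed hG pP (@comp_closed x) (subsetUl _ _)) ?cov.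
rewrite cardsU1 c4 -c3 c1 c2; suff -> : x \notin cover (restr H (comp x)) by [].
by apply: contra xH; apply/subsetP/coverS/restr_sub.
Qed.

Lemma mateE N u v z : matching G N -> [set u; v] \in N -> ([set u;
  z] \in N) = (z == v).
Proof.
move=> mN uv; apply/idP/eqP => [uz|-> //]; exact: mate_uniq mN uz uv.
Qed.

Lemma no_mate (N : {set {set T}}) u z : u \notin cover N -> ([set u;
  z] \in N) = false.
Proof. by move=> nu; apply: contraNF nu => /adj_cover[]. Qed.

(** The path that becomes a side of a spanner with 3-vertex [v2]: its edges lie in [H'], [H], [H'],
    [H] in turn, and both end edges lie in [M]. *)
Record side x v1 v2 v3 v4 : Prop := Side {
  side_M1 : [set x; v1] \in M;
  side_H'1 : [set x; v1] \in H';
  side_x : x \notin cover H;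
  side_H1 : [set v1; v2] \in H;
  side_H'2 : [set v2; v3] \in H';
  side_M2 : [set v3; v4] \in M;
  side_H2 : [set v3; v4] \in H;
  side_4 : v4 \notin cover H';
  side_uniq : uniq [:: x; v1; v2; v3; v4];
  side_comp : comp x = [set u in [:: x; v1; v2; v3; v4]] }.

Lemma ext_side x : x \in X -> exists v1 v2 v3 v4, side x v1 v2 v3 v4.
Proof.
move=> xX; have [xM xH] := setDP xX; have [v1 M1] := mate hG mM xM.
have H'1 := ext_mate xX M1; have [v2 H1] := mate hG mH (ext_mate_cover xX M1).
have [_ cov] := ext_comp xH; have cK := card_comp xX.
have H'1s : [set v1; x] \in H' by rewrite setUC.
have H1s : [set v2; v1] \in H by rewrite setUC.
have n01 : x != v1 := edge_neq hG (matching_adj hG mM M1).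
have nx v u : [set v; u] \in H -> (x != v) && (x != u).
  by move=> /adj_cover[h1 h2]; rewrite !(contraNneq _ xH) // => ->.
have /andP[_ n02] := nx _ _ H1.
have n12 : v1 != v2 := edge_neq hG (matching_adj hG mH H1).
(* If [H'] missed [v2], the component would consist of [x], [v1], [v2] alone, but it has five
   vertices. *)
have [v3 H'2] : exists v3, [set v2; v3] \in H'.
  apply: (mate hG mH'); apply: contraT => v2H'.
  suff /subset_leq_card : comp x \subset [set u in [:: x; v1; v2]].
    by rewrite cK cardsE => /leq_trans/(_ (card_size _)).
  apply/subsetP => u uK; have {uK}cu : connect (adj D) x u by rewrite inE in uK.
  rewrite -(@closed_connect _ (adj D) [set u in [:: x; v1; v2]] _ _ _ cu).
    by rewrite !inE eqxx.
  apply: intro_closed; first exact: connect_adj_sym.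
  move=> {cu}u w; rewrite /adj in_setU !inE => /orP[]uw /or3P[]/eqP E; move: uw;
    rewrite {}E.
  - by rewrite no_mate.
  - by rewrite (mateE _ mH H1) => ->; rewrite !orbT.
  - by rewrite (mateE _ mH H1s) => ->; rewrite !orbT.
  - by rewrite (mateE _ mH' H'1) => ->; rewrite !orbT.
  - by rewrite (mateE _ mH' H'1s) => ->.
  - by rewrite no_mate.
have H'2s : [set v3; v2] \in H' by rewrite setUC.
have n23 : v2 != v3 := edge_neq hG (matching_adj hG mH' H'2).
have n03 : x != v3.
  by apply: contraNneq n12 => E; rewrite -E in H'2s;
    rewrite (mate_uniq mH' H'2s H'1).
have n13 : v1 != v3.
  by apply: contraNneq n02 => E; rewrite -E in H'2s;
    rewrite (mate_uniq mH' H'2s H'1s).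
have k0 := comp_refl x.
have k1 : v1 \in comp x by apply: comp_adj k0; rewrite in_setU H'1 orbT.
have k2 : v2 \in comp x by apply: comp_adj k1; rewrite in_setU H1.
have k3 : v3 \in comp x by apply: comp_adj k2; rewrite in_setU H'2 orbT.
have n30 : v3 != x by rewrite eq_sym.
have [v4 H2] := mate hG mH (cov v3 k3 n30).
have k4 : v4 \in comp x by apply: comp_adj k3; rewrite in_setU H2.
have H2s : [set v4; v3] \in H by rewrite setUC.
have n34 : v3 != v4 := edge_neq hG (matching_adj hG mH H2).
have /andP[_ n04] := nx _ _ H2.
have n14 : v1 != v4.
  by apply: contraNneq n23 => E; rewrite -E in H2s; rewrite (mate_uniq mH H2s H1).
have n24 : v2 != v4.
  by apply: contraNneq n13 => E; rewrite -E in H2s; rewrite (mate_uniq mH H2s H1s).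
have un : uniq [:: x; v1; v2; v3; v4].
  by rewrite /= !inE !negb_or n01 n02 n03 n04 n12 n13 n14 n23 n24 n34.
have KE : comp x = [set u in [:: x; v1; v2; v3; v4]].
  apply/esym/eqP; rewrite eqEcard cK cardsE (card_uniqP un) andbT.
  by apply/subsetP => u; rewrite in_set !in_cons =>
    /or3P[/eqP->|/eqP->|/or3P[/eqP->|/eqP->|/orP[/eqP->|]]].
(* The component has only one [H]-edge outside [M], and [v1 v2] is such an edge. *)
have M2 : [set v3; v4] \in M.
  apply: contraT => nM.
  have nM1 : [set v1; v2] \notin M.
    apply: contra n02 => M12; apply/eqP/(mate_uniq mM (_ : [set v1; x] \in M) M12).
    by rewrite setUC.
  have : [set v1; v2] = [set v3; v4].
    apply: (ext_tight_HM.2 x _ _ xX).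
    - by rewrite in_setD nM1.
    - by rewrite in_setD nM.
    - by rewrite subUset !sub1set k1 k2.
    - by rewrite subUset !sub1set k3 k4.
  by case/set2_eqP => -[E1 E2]; rewrite ?E1 ?E2 eqxx in n13 n14 n24.
exists v1, v2, v3, v4; split=> //.
(* An [H']-edge at [v4] would stay in the component, whose other four vertices already have their
   [H']-mates among themselves. *)
apply/negP => /(mate hG mH')[w H'w].
have : w \in comp x by apply: comp_adj k4; rewrite in_setU H'w orbT.
have ws : [set w; v4] \in H' by rewrite setUC.
rewrite KE in_set !in_cons in_nil orbF.
case/or3P=> [/eqP E|/eqP E|/or3P[/eqP E|/eqP E|/eqP E]]; move: ws; rewrite E.
- by rewrite (mateE _ mH' H'1) eq_sym (negPf n14).
- by rewrite (mateE _ mH' H'1s) eq_sym (negPf n04).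
- by rewrite (mateE _ mH' H'2) eq_sym (negPf n34).
- by rewrite (mateE _ mH' H'2s) eq_sym (negPf n24).
- by move=> /(matching_adj hG mH')/(edge_neq hG); rewrite eqxx.
Qed.

Lemma side_X x v1 v2 v3 v4 : side x v1 v2 v3 v4 -> x \in X.
Proof. by case=> M1 _ xH *; rewrite in_setD xH; case: (adj_cover M1). Qed.

(** Let [w] be the [M]-mate of [v2]. It is covered by [H], since otherwise its [M]-edge would lie in
    [H'] and [w] would be [v3]. Its [H]-edge is outside [M], hence is the edge [v1' v2'] of some
    side. Finally [w] is not [v1'], whose [M]-mate is missed by [H] while [v2] is not. *)
Lemma ext_partner x v1 v2 v3 v4 : side x v1 v2 v3 v4 ->
  exists x' v1' v2' v3' v4', side x' v1' v2' v3' v4' /\ [set v2; v2'] \in M.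
Proof.
move=> s; case: (s) => M1 H'1 xH H1 H'2 M2 H2 v4H' un KE; have xX := side_X s.
have [v1H v2H] := adj_cover H1.
have [/subsetP sHM _ _] := ext_tight; have [w Mw] := mate hG mM (sHM _ v2H).
have Mws : [set w; v2] \in M by rewrite setUC.
have M1s : [set v1; x] \in M by rewrite setUC.
have H1s : [set v2; v1] \in H by rewrite setUC.
have wH : w \in cover H.
  apply: contraT => wH; have wX : w \in X by rewrite in_setD wH;
    case: (adj_cover Mw).
  have := ext_mate wX Mws; rewrite setUC => H'w.
  by have [v3H _] := adj_cover H2; rewrite (mate_uniq mH' H'w H'2) v3H in wH.
have [u Hu] := mate hG mH wH.
have uM : [set w; u] \notin M.
  apply/negP => Mu; have E := mate_uniq mM Mu Mws; subst u.
  rewrite setUC in Hu; have E := mate_uniq mH Hu H1s; subst w.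
  by rewrite (mate_uniq mM M1s Mws) v2H in xH.
have dHM : [set w; u] \in H :\: M by rewrite in_setD uM.
have [x' xX' sd] := ext_tight_HM.1 _ dHM.
have [v1' [v2' [v3' [v4' s']]]] := ext_side xX'.
exists x', v1', v2', v3', v4'; split=> //.
case: s' => M1' _ xH' H1' _ _ _ _ un' KE'.
have M1s' : [set v1'; x'] \in M by rewrite setUC.
have dHM' : [set v1'; v2'] \in H :\: M.
  rewrite in_setD H1' andbT; apply/negP => M12.
  by have [_ h] := adj_cover H1'; rewrite (mate_uniq mM M1s' M12) h in xH'.
have sd' : [set v1'; v2'] \subset comp x'.
  by rewrite KE' subUset !sub1set !inE !eqxx !orbT.
have /set2_eqP[[E _]|[E _]] := ext_tight_HM.2 _ _ _ xX' dHM dHM' sd sd'.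
  by rewrite E in Mws; rewrite (mate_uniq mM M1s' Mws) v2H in xH'.
by rewrite -E.
Qed.

Definition extremal_forest : rel T := adj (H :|: H' :|: M).

Lemma side_adj x v1 v2 v3 v4 w z : side x v1 v2 v3 v4 -> [set v2; w] \in M ->
  [/\ extremal_forest x z = (z == v1),
      extremal_forest v1 z = (z == x) || (z == v2),
      extremal_forest v2 z = [|| z == v1, z == v3 | z == w],
      extremal_forest v3 z = (z == v2) || (z == v4) &
      extremal_forest v4 z = (z == v3)].
Proof.
case=> M1 H'1 xH H1 H'2 M2 H2 v4H' _ _ Mw.
have sw (N : {set {set T}}) u v : [set u; v] \in N -> [set v;
  u] \in N by rewrite setUC.
rewrite /extremal_forest /adj !in_setU.
rewrite !(no_mate _ xH) !(no_mate _ v4H') (mateE _ mH' H'1) (mateE _ mM M1).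
rewrite (mateE _ mH H1) (mateE _ mH' (sw _ _ _ H'1)) (mateE _ mM (sw _ _ _ M1)).
rewrite (mateE _ mH (sw _ _ _ H1)) (mateE _ mH' H'2) (mateE _ mM Mw).
rewrite (mateE _ mH H2) (mateE _ mH' (sw _ _ _ H'2)) (mateE _ mM M2).
rewrite (mateE _ mH (sw _ _ _ H2)) (mateE _ mM (sw _ _ _ M2)).
by split; case: (z == x); case: (z == v1); case: (z == v2); case: (z == v3);
  case: (z == v4); case: (z == w).
Qed.

Lemma extremal_forest_sym : symmetric extremal_forest.
Proof. exact: adj_sym. Qed.

Lemma extremal_forest_sub : subrel extremal_forest G.
Proof.
move=> x y; rewrite /extremal_forest /adj !in_setU.
by case/orP=> [/orP[/(matching_adj hG mH)|/(matching_adj hG mH')]|/(matching_adj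
  hG mM)].
Qed.

(** A vertex of [cover M] is exposed itself, or its [H]-edge lies in the component of an exposed
    vertex by tightness. The side found there and its partner form a spanner. *)
Lemma extremal_charted : charted extremal_forest (cover M).
Proof.
move=> y yM.
have [x xX yx] : exists2 x, x \in X & y \in comp x.
  have [yH|yH] := boolP (y \in cover H); last first.
    by exists y; rewrite ?comp_refl // in_setD yH.
  have [z Hyz] := mate hG mH yH.
  have [Myz|Myz] := boolP ([set y; z] \in M).
    have [|x xX sd] := ext_tight_MH.1 [set y; z]; first by rewrite in_setI Myz.
    by exists x => //; apply: (subsetP sd); rewrite set21.
  have [|x xX sd] := ext_tight_HM.1 [set y; z]; first by rewrite in_setD Myz.
  by exists x => //; apply: (subsetP sd); rewrite set21.
have [v1 [v2 [v3 [v4 s]]]] := ext_side xX.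
have [x' [v1' [v2' [v3' [v4' [s' Mw]]]]]] := ext_partner s.
have Mws : [set v2'; v2] \in M by rewrite setUC.
pose l1 := [:: x; v1; v2; v3; v4]; pose l2 := [:: x'; v1'; v2'; v3'; v4'].
pose l := l1 ++ l2; pose phi := nth x l.
(* If the two sides met, they would be the same side, and the [M]-edge joining their centres would
   be a loop. *)
have un : uniq l.
  rewrite cat_uniq (side_uniq s) (side_uniq s') andbT; apply/hasPn => u ul'.
  apply/negP => ul.
  have E : x = x'.
    apply: (comp_inj xX (side_X s') (v := u)).
      by rewrite (side_comp s) in_set.
    by rewrite (side_comp s') in_set.
  subst x'.
  have E1 := mate_uniq mM (side_M1 s) (side_M1 s'); subst v1'.
  have E2 := mate_uniq mH (side_H1 s) (side_H1 s'); subst v2'.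
  by have := edge_neq hG (matching_adj hG mM Mw); rewrite eqxx.
exists phi; split.
- split=> [i j ilt jlt /eqP|i z lti]; first by rewrite nth_uniq // => /eqP.
  have [a0 a1 a2 a3 a4] := side_adj z s Mw.
  have [a5 a6 a7 a8 a9] := side_adj z s' Mws.
  do 10?[case: i lti => [|i] lti] => //; rewrite /phi /= !inE.
  + exact: a0.
  + exact: a1.
  + exact: a2.
  + exact: a3.
  + exact: a4.
  + exact: a5.
  + exact: a6.
  + exact: a7.
  + exact: a8.
  + exact: a9.
- have /(nthP x)[i lti <-] : y \in l1 by rewrite (side_comp s) in_set in yx.
  apply/spanP; exists i; first by apply: leq_trans lti _.
  by rewrite /phi /l nth_cat lti.
apply/subsetP => u /spanP[i lti ->].
have c1 := adj_cover (side_M1 s); have c2 := adj_cover (side_M2 s).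
have c3 := adj_cover (side_M1 s'); have c4 := adj_cover (side_M2 s').
have c5 := adj_cover Mw.
by do 10?[case: i lti => [|i] lti] => //; rewrite /phi /= ?c1 ?c2 ?c3 ?c4 ?c5.
Qed.

End Extremal.

(** * Numbered spanner vertices, S-forests, degrees and bases *)

Definition vertex_of_code (n : nat) : bool * 'I_5 :=
  (n < 5, Ordinal (ltn_pmod n (isT : 0 < 5))).

Definition code_of_vertex (v : bool * 'I_5) : nat := (if v.1 then 0 else 5) + v.2.

Lemma code_lt v : code_of_vertex v < 10.
Proof. by case: v => [[] i]; rewrite /code_of_vertex /=; have := ltn_ord i;
  lia. Qed.

Lemma code_of_vertexK v : vertex_of_code (code_of_vertex v) = v.
Proof.
case: v => [b [i lti]]; rewrite /vertex_of_code /code_of_vertex; apply/eqP.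
rewrite xpair_eqE -val_eqE /=; case: b => /=;
  first by rewrite add0n lti modn_small ?eqxx.
by rewrite modnDl modn_small // eqxx andbT ltnNge leq_addr.
Qed.

Lemma vertex_of_code_inj : {in gtn 10 &, injective vertex_of_code}.
Proof.
move=> i j; rewrite !unfold_in /= => lti ltj /eqP.
rewrite xpair_eqE -val_eqE /= => /andP[/eqP E /eqP]; lia.
Qed.

Lemma spanner_code i j : i < 10 -> j < 10 ->
  spanner (vertex_of_code i) (vertex_of_code j) = (j \in nb i).
Proof. by do 10?[case: i => [|i] //]; do 10?[case: j => [|j] //]. Qed.

Lemma ucycle_two_nbrs (T : finType) (e : rel T) c x : symmetric e -> ucycle e c ->
  2 < size c -> x \in c -> exists y z, [/\ y \in c, z \in c, y != z, e x y & e x z].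
Proof.
move=> se uc sc xc; have [i c' E] := rot_to xc.
have : ucycle e (x :: c') by rewrite -E rot_ucycle.
have mc : c =i x :: c' by move=> v; rewrite -E mem_rot.
have : 2 < size (x :: c') by rewrite -E size_rot.
case: c' {E} mc => [|y [|w s]] // mc _ /andP[/=]; rewrite rcons_path.
case/and4P=> exy eyw _ elx /and3P[_ ny _].
exists y, (last w s); rewrite !mc exy se elx; split=> //.
- by rewrite !inE eqxx orbT.
- by rewrite 2!in_cons mem_last !orbT.
- by apply: contraNneq ny => ->; apply: mem_last.
Qed.

Section Forest.

Variables (T : finType) (F : rel T).

Lemma S_forest_charted : S_forest F -> charted F setT.
Proof.
case=> -[sF _] _ hF x _; have [phi [inj con adjE]] := hF x.
exists (phi \o vertex_of_code); split; last exact: subsetT.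
  split=> [i j ilt jlt /= /inj E|i z lti /=]; first exact: vertex_of_code_inj E.
  apply/idP/mapP => [Fz|[j jn ->]];
    last by rewrite /= adjE spanner_code // (nb_lt jn).
  have /con[k kE] : connect F x z.
    apply: connect_trans (connect1 Fz); apply/con;
      exact: (ex_intro _ (vertex_of_code i)).
  exists (code_of_vertex k); last by rewrite /= code_of_vertexK.
  by move: Fz; rewrite -kE adjE -{1}(code_of_vertexK k) spanner_code // code_lt.
have /con[k kE] := connect0 F x.
by apply/spanP; exists (code_of_vertex k); rewrite ?code_lt //= code_of_vertexK.
Qed.

Hypotheses (sF : symmetric F) (cF : charted F setT).

Lemma chart_everywhere x : exists phi r, [/\ chart F phi, r < 3 & x = phi r].
Proof.
have [phi [r [cphi _ ltr E]]] := charted_at cF (in_setT x).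
by exists phi, r.
Qed.

(** A vertex of a cycle has two neighbours on it. This excludes the 1-vertices, then the 2-vertices,
    and then the 3-vertices, which are left with one neighbour each. *)
Lemma charted_acyclic : acyclic F.
Proof.
move=> c sc uc.
have two x : x \in c -> exists y z, [/\ y \in c, z \in c, y != z, F x y & F x z].
  exact: ucycle_two_nbrs.
have n0 phi : chart F phi -> phi 0 \notin c.
  move=> [_ h]; apply/negP => /two[y [z [_ _ yz]]].
  by rewrite !h // !inE => /eqP Ey /eqP Ez; rewrite Ey Ez eqxx in yz.
have n1 phi : chart F phi -> phi 1 \notin c.
  move=> cphi; have no := n0 _ cphi; apply/negP => /two[y [z [yc zc yz]]].
  rewrite !cphi.2 // !inE => /orP[]/eqP Ey /orP[]/eqP Ez;
    rewrite Ey Ez in yz yc zc; by rewrite ?eqxx ?yc ?zc in yz no.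
have n2 phi : chart F phi -> phi 2 \notin c.
  move=> cphi; have no1 := n1 _ cphi.
  have [c3 _] := chart_relabel (s := [:: 4; 3; 2; 1; 0; 5; 6; 7; 8; 9]) isT cphi.
  have no3 : phi 3 \notin c by apply: n1 c3.
  apply/negP => /two[y [z [yc zc yz]]].
  rewrite !cphi.2 // !inE => /or3P[]/eqP Ey /or3P[]/eqP Ez;
    rewrite Ey Ez in yz yc zc; by rewrite ?eqxx ?yc ?zc in yz no1 no3.
case: c sc two n0 n1 n2 {uc} => // x c _ _ n0 n1 n2.
have [phi [r [cphi ltr E]]] := chart_everywhere x.
have := mem_head x c; rewrite {1}E.
by case: r ltr {E} => [|[|[|//]]] _; apply/negP; auto.
Qed.

Lemma charted_S_forest : irreflexive F -> S_forest F.
Proof.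
move=> irF; split=> //; first exact: charted_acyclic.
move=> x; have [phi [cphi xp _]] := cF (in_setT x).
exists (phi \o code_of_vertex); split.
- move=> u v /= /(cphi.1 _ _ (code_lt u) (code_lt v)) E.
  by rewrite -(code_of_vertexK u) E code_of_vertexK.
- move=> y; rewrite (span_connectE sF _ cphi xp); split.
    case/spanP=> i lti ->; exists (vertex_of_code i) => /=; congr phi.
    apply: vertex_of_code_inj; rewrite ?unfold_in /= ?code_lt //.
    by rewrite code_of_vertexK.
  by case=> v <-; apply/mem_span/code_lt.
- move=> u v /=; rewrite (chart_nb cphi) ?code_lt // -spanner_code ?code_lt //.
  by rewrite !code_of_vertexK.
Qed.

Lemma chart_degree phi i : chart F phi -> i < 10 -> degree F (phi i) = size (nb i).
Proof.
move=> cphi lti; rewrite /degree -(size_map phi).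
have /card_uniqP <- : uniq (map phi (nb i)).
  rewrite map_inj_in_uniq; first by do 10?[case: i lti => [|i] lti] => //.
  by move=> j k /nb_lt jl /nb_lt kl; apply: cphi.1.
by rewrite -cardsE; apply: eq_card => z; rewrite !in_set cphi.2.
Qed.

(** Both sides are additive over the components, and each component has [k] such vertices among its
    ten. *)
Lemma card_class i k : count (fun j => size (nb j) == i) (iota 0 10) = k ->
  #|[set x | ivertex F i x]| * 10 = #|T| * k.
Proof.
move=> ck; rewrite -cardsT -[[set x | _]]setTI.
pattern [set: T]; apply: (charted_ind sF _ _ cF) => [|phi W cphi dis IH].
  by rewrite set0I !cards0.
rewrite setIUl !cardsU (_ : _ :&: _ :&: _ = set0); last first.
  apply/eqP; rewrite setI_eq0; apply: disjointWl (disjointWr _ dis);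
    exact: subsetIl.
rewrite (eqP (_ : sspan phi :&: W == set0)) ?setI_eq0 // cards0 !subn0 !mulnDl IH.
rewrite (card_span cphi) mulnC -ck; congr (_ * _ + _).
have -> : sspan phi :&: [set x | ivertex F i x] =
    [set x in [seq phi j | j <- iota 0 10 & size (nb j) == i]].
  apply/setP => x; rewrite in_setI [x \in [set x | ivertex F i x]]in_set
    [RHS]in_set.
  apply/andP/mapP => [[/spanP[j ltj ->]]|[j]].
    by rewrite /ivertex (chart_degree cphi ltj) => h; exists j;
      rewrite // mem_filter h mem_iota.
  rewrite mem_filter mem_iota => /andP[h ltj] ->.
  by rewrite mem_span // /ivertex (chart_degree cphi ltj).
rewrite cardsE (card_uniqP _) ?size_map ?size_filter //.
rewrite map_inj_in_uniq ?filter_uniq ?iota_uniq // => j k'.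
by rewrite !mem_filter !mem_iota => /andP[_ jl] /andP[_ kl]; apply: cphi.1.
Qed.

Lemma card_1vertices : #|[set x | ivertex F 1 x]| * 10 = #|T| * 4.
Proof. exact: card_class. Qed.

Lemma card_2vertices : #|[set x | ivertex F 2 x]| * 10 = #|T| * 4.
Proof. exact: card_class. Qed.

Lemma chart_ivertex phi r : chart F phi -> r < 3 ->
  forall i, ivertex F i (phi r) = (r.+1 == i).
Proof.
move=> cphi ltr i; rewrite /ivertex (chart_degree cphi); last by lia.
by case: r ltr => [|[|[|]]].
Qed.

Lemma chart_walk2 phi z n : chart F phi -> ivertex F 3 z -> n < 3 ->
  walk F n (phi 0) z -> z = phi 2.
Proof.
move=> cphi z3 ltn /existsP[p /andP[pp /eqP lp]].
have iv := chart_ivertex cphi.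
have [h0 h1] : z <> phi 0 /\ z <> phi 1.
  by split=> E; rewrite E iv in z3.
case: n ltn p pp lp => [|[|[|//]]] _ p.
- by rewrite (tuple0 p) /= => _ E; case: h0.
- case/tupleP: p => y p; rewrite (tuple0 p) /= cphi.2 // andbT inE => /eqP-> E.
  by case: h1.
case/tupleP: p => y p; case/tupleP: p => w p;
  rewrite (tuple0 p) /= andbT cphi.2 // inE.
case/andP=> /eqP->; rewrite cphi.2 // !inE => /orP[]/eqP-> E //; by case: h0.
Qed.

Lemma chart_base phi y : chart F phi -> is_base F (phi 0) y = (y == phi 2).
Proof.
move=> cphi; have iv := chart_ivertex cphi.
(* [dist] only searches lengths below [#|T|], so length 2 has to be in range. *)
have T10 : 10 <= #|T| by rewrite -(card_span cphi) max_card.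
have d2 : dist F (phi 0) (phi 2) <= 2.
  have w2 : walk F 2 (phi 0) (phi 2).
    apply/existsP; exists [tuple phi 1; phi 2]; rewrite /= eqxx andbT.
    by rewrite !(chart_nb cphi).
  rewrite /dist leqNgt; apply/negP => /(before_find 0).
  by rewrite nth_iota ?add0n ?w2 //; lia.
have far z : ivertex F 3 z -> dist F (phi 0) z <= 2 -> z = phi 2.
  move=> z3 dz; have ltT : dist F (phi 0) z < size (iota 0 #|T|)
    by rewrite size_iota; lia.
  have : walk F (nth 0 (iota 0 #|T|) (dist F (phi 0) z)) (phi 0) z.
    by apply: (nth_find 0 (a := fun n => walk F n (phi 0) z)); rewrite has_find.
  by rewrite size_iota in ltT; rewrite nth_iota // add0n; apply: chart_walk2.
apply/and3P/eqP => [[y3 _ /forallP/(_ (phi 2))]|->].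
  by rewrite iv //= => dy; apply: far => //; apply: leq_trans d2.
split; first by rewrite iv.
  by apply: (span_connect sF cphi); apply: mem_span.
apply/forallP => z; apply/implyP => z3;
  case: (leqP (dist F (phi 0) z) 2) => [dz|dz].
  by rewrite (far z).
by apply: leq_trans d2 (ltnW dz).
Qed.

End Forest.

(** * Counting neighbours and edges *)

Section EdgeCount.

Variables (T : finType) (G : rel T).
Hypothesis hG : simple_graph G.

Lemma deg_nbrs (D : {set {set T}}) x : D \subset edges G ->
  deg D x = #|[set y | [set x; y] \in D]|.
Proof.
move=> sD; rewrite /deg -(card_imset _ (@set2_inj T x)); apply: eq_card => d.
rewrite inE; apply/andP/imsetP => [[dD xd]|[y]]; last by rewrite inE => dD ->;
  rewrite dD set21.
have [y [_ E]] := edge_at hG (subsetP sD _ dD) xd.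
by exists y; rewrite // inE -E.
Qed.

Lemma sum_deg (D : {set {set T}}) : D \subset edges G -> \sum_x deg D x = #|D| * 2.
Proof.
move=> sD; rewrite -sum_nat_const.
transitivity (\sum_(x : T) \sum_(d in D) (x \in d : nat)).
  apply: eq_bigr => x _; rewrite -big_mkcondr sum1dep_card.
  by apply: eq_card => d; rewrite !inE.
rewrite exchange_big; apply: eq_bigr => d dD /=.
by rewrite -big_mkcond sum1_card (card_edge hG (subsetP sD _ dD)).
Qed.

End EdgeCount.

(** * The sets [U], [L], [Delta] and [B] read in a chart *)

Section Tables.

Variables (T : finType) (G F : rel T).
Hypotheses (hG : simple_graph G) (hF : simple_graph F) (sub : subrel F G).
Hypothesis cF : charted F setT.
Implicit Types (x y z : T) (phi : nat -> T).

Let sF : symmetric F := proj1 hF.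

Lemma exists_set2 (P : pred T) x y : [exists z in [set x; y], P z] = P x || P y.
Proof.
apply/exists_inP/orP => [[z /set2P[]-> Pz]|[Px|Py]]; first by left.
- by right.
- by exists x; rewrite ?set21.
- by exists y; rewrite ?set22.
Qed.

Lemma in_U x y : ([set x; y] \in U F) = F x y && (ivertex F 1 x || ivertex F 1 y).
Proof. by rewrite inE (edgeE hF) exists_set2. Qed.

Lemma in_L x y : ([set x; y] \in L F) =
  [&& F x y, ~~ (ivertex F 1 x || ivertex F 1 y) & ivertex F 2 x || ivertex F 2 y].
Proof.
rewrite inE in_setD in_U (edgeE hF) exists_set2.
by case: (F x y); rewrite ?andbF ?andbT.
Qed.

Lemma in_Delta x y : ([set x; y] \in Delta G F) =
  G x y && (ivertex F 1 x && is_base F x y || ivertex F 1 y && is_base F y x).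
Proof.
rewrite inE (edgeE hG); congr (_ && _); apply/existsP/orP.
  case=> u /existsP[v /and3P[/eqP/set2_eqP[] [-> ->] iv bv]]; first by left;
    rewrite iv.
  by right; rewrite iv.
case=> /andP[iv bv]; first by exists x; apply/existsP; exists y; rewrite eqxx iv.
by exists y; apply/existsP; exists x; rewrite setUC eqxx iv.
Qed.

Lemma in_B x y : ([set x; y] \in B G F) =
  G x y && ~~ [|| [set x; y] \in L F, [set x; y] \in U F | [set x;
    y] \in Delta G F].
Proof. by rewrite in_setD !in_setU (edgeE hG) andbC -orbA. Qed.

Lemma U_edges : U F \subset edges G.
Proof.
apply/subsetP => d; rewrite inE => /andP[/edgeP[x [y [Fxy ->]]] _].
by rewrite (edgeE hG) sub.
Qed.

Lemma L_edges : L F \subset edges G.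
Proof.
apply/subsetP => d; rewrite inE => /andP[/setDP[/edgeP[x [y [Fxy ->]]] _] _].
by rewrite (edgeE hG) sub.
Qed.

Lemma B_edges : B G F \subset edges G.
Proof. exact: subsetDl. Qed.

Lemma disjoint_L_U : [disjoint L F & U F].
Proof.
apply/pred0P => d /=; apply/negP => /andP[/setIdP[/setDP[_ nU] _]].
exact/negP.
Qed.

Section AtChart.

Variables (phi : nat -> T) (z : T).
Hypothesis cphi : chart F phi.

Lemma chart_iv i j : i < 10 -> ivertex F j (phi i) = (size (nb i) == j).
Proof. by move=> lti; rewrite /ivertex (chart_degree cphi). Qed.

Lemma chart_U0 : ([set phi 0; z] \in U F) = (z == phi 1).
Proof. by rewrite in_U cphi.2 // chart_iv //= !inE andbT. Qed.

Lemma chart_neq i j : i < 10 -> j < 10 -> i != j -> (phi i == phi j) = false.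
Proof. by move=> lti ltj ij; apply: contraNF ij => /eqP /cphi.1 ->. Qed.

Lemma chart_U1 : ([set phi 1; z] \in U F) = (z == phi 0).
Proof.
rewrite in_U cphi.2 // chart_iv //= !inE; case: eqVneq => [->|_] /=.
  by rewrite chart_iv.
by case: eqVneq => [->|//]; rewrite chart_iv.
Qed.

Lemma chart_U2 : ([set phi 2; z] \in U F) = false.
Proof.
rewrite in_U cphi.2 // chart_iv //= !inE.
by apply/negP => /andP[/or3P[]/eqP->]; rewrite chart_iv.
Qed.

Lemma chart_L0 : ([set phi 0; z] \in L F) = false.
Proof. by rewrite in_L chart_iv //= andbF. Qed.

Lemma chart_L1 : ([set phi 1; z] \in L F) = (z == phi 2).
Proof.
rewrite in_L cphi.2 // !chart_iv //= !inE andbT; case: eqVneq => [->|_] /=.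
  by rewrite chart_iv // chart_neq.
by case: eqVneq => [->|//]; rewrite chart_iv.
Qed.

Lemma chart_L2 : ([set phi 2; z] \in L F) = (z == phi 1) || (z == phi 3).
Proof.
rewrite in_L cphi.2 // !chart_iv //= !inE.
case: eqVneq => [->|_] /=; first by rewrite !chart_iv.
case: eqVneq => [->|_] /=; first by rewrite !chart_iv.
by case: eqVneq => [->|//]; rewrite !chart_iv.
Qed.

Lemma chart_Delta0 : ([set phi 0; z] \in Delta G F) = G (phi 0) z && (z == phi 2).
Proof.
rewrite in_Delta chart_iv //= (chart_base sF _ cphi); congr (_ && _).
rewrite /is_base chart_iv //=.
by case: (ivertex F 1 z); rewrite ?orbF.
Qed.

Lemma chart_Delta1 : ([set phi 1; z] \in Delta G F) = false.
Proof. by rewrite in_Delta /is_base !chart_iv //= !andbF. Qed.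

End AtChart.

Lemma chart_deg phi : chart F phi ->
  [/\ deg (U F) (phi 0) = 1, deg (U F) (phi 1) = 1 & deg (U F) (phi 2) = 0] /\
  [/\ deg (L F) (phi 0) = 0, deg (L F) (phi 1) = 1 & deg (L F) (phi 2) = 2].
Proof.
move=> cphi; rewrite !(deg_nbrs hG _ U_edges) !(deg_nbrs hG _ L_edges).
split; split.
- by apply/eqP/cards1P; exists (phi 1); apply/setP => z;
  rewrite in_set in_set1 chart_U0.
- by apply/eqP/cards1P; exists (phi 0); apply/setP => z;
  rewrite in_set in_set1 chart_U1.
- by apply/eqP; rewrite cards_eq0; apply/eqP/setP => z;
  rewrite in_set in_set0 chart_U2.
- by apply/eqP; rewrite cards_eq0; apply/eqP/setP => z;
  rewrite in_set in_set0 chart_L0.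
- by apply/eqP/cards1P; exists (phi 2); apply/setP => z;
  rewrite in_set in_set1 chart_L1.
- rewrite (_ : [set y | _] = [set phi 1; phi 3]);
  first by rewrite cards2 (chart_neq cphi).
  by apply/setP => z; rewrite in_set in_set2 chart_L2.
Qed.

(** [U F :|: L F] is the union of all sides, that is, [F] without the edges joining 3-vertices. *)
Lemma deg_UL x : deg (U F :|: L F) x = if ivertex F 1 x then 1 else 2.
Proof.
have [phi [r [cphi ltr ->]]] := chart_everywhere cF x.
have [[u0 u1 u2] [l0 l1 l2]] := chart_deg cphi.
rewrite degU; last by rewrite disjoint_sym disjoint_L_U.
rewrite (chart_ivertex cphi ltr).
by case: r ltr => [|[|[|//]]] _ /=; rewrite ?u0 ?u1 ?u2 ?l0 ?l1 ?l2.
Qed.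

(** Four vertices in ten are 1-vertices, each lowering the sum [#|T| * 2] by one. *)
Lemma sum_deg_weight : (\sum_x (if ivertex F 1 x then 1 else 2)) * 10 = #|T| * 16.
Proof.
have := card_1vertices sF cF.
have E : \sum_x (if ivertex F 1 x then 1 else 2) + #|[set x | ivertex F 1 x]| =
  #|T| * 2.
  have -> : #|[set x | ivertex F 1 x]| = \sum_x (ivertex F 1 x : nat).
    by rewrite -sum1dep_card big_mkcond; apply: eq_bigr => x _; case: ifP.
  by rewrite -big_split /= -sum_nat_const; apply: eq_bigr => x _; case: ifP.
lia.
Qed.

Lemma card_UL : #|U F :|: L F| * 10 = #|T| * 8.
Proof.
have := sum_deg_weight.
have := sum_deg hG (_ : U F :|: L F \subset edges G).
rewrite subUset U_edges L_edges => /(_ isT).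
rewrite (eq_bigr (fun x => if ivertex F 1 x then 1 else 2)) => [|x _];
  last exact: deg_UL.
lia.
Qed.

Lemma chart_at_class x i : ivertex F i.+1 x -> exists2 phi, chart F phi & x = phi i.
Proof.
have [phi [r [cphi ltr ->]]] := chart_everywhere cF x.
by rewrite (chart_ivertex cphi ltr) eqSS => /eqP <-; exists phi.
Qed.

End Tables.

(** * Parity along alternating trails *)

Section Trails.

Variable T : finType.
Implicit Types (v x : T) (s : seq {set T}) (P Q : {set {set T}}).

(** With [b = false] the edges at [v] in positions 0, 2, 4, ... are counted, with [b = true] those
    in positions 1, 3, 5, ... *)
Fixpoint parity_count v (b : bool) s : nat :=
  if s is d :: s' then (~~ b && (v \in d)) + parity_count v (~~ b) s' else 0.

(** Each passage of the trail through [v] uses consecutive edges, one of each parity, so only the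
    two ends of the trail can unbalance the counts. *)
Lemma trail_parity (G : rel T) v x p : irreflexive G -> path G x p ->
  if odd (size p)
  then parity_count v false (trail_edges x p) =
       parity_count v true (trail_edges x p) + (v == x) + (v == last x p)
  else parity_count v false (trail_edges x p) + (v == last x p) =
       parity_count v true (trail_edges x p) + (v == x).
Proof.
move=> irG; elim: p x => [|y p IHp] x //= /andP[Gxy /IHp].
have -> : (v \in [set x; y]) = (v == x) + (v == y) :> nat.
  rewrite !inE; case: (eqVneq v x) => [->|_] //=.
  by case: eqVneq => // E; rewrite E irG in Gxy.
rewrite -/(trail_edges y p) add0n; case: (odd _) => /=; lia.
Qed.

Fixpoint alternates P Q s : bool :=
  if s is d :: s' then (d \in P) && alternates Q P s' else true.

Lemma alternatesP P Q s : reflect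
  (forall i, i < size s -> nth set0 s i \in if odd i then Q else P) (alternates P
    Q s).
Proof.
elim: s P Q => [|d s IHs] P Q /=; first by constructor.
apply: (iffP andP) => [[dP /IHs h] [|i] //= lti|h].
  by have := h i lti; case: (odd i).
split; first exact: (h 0).
by apply/IHs => i lti; have := h i.+1 lti; rewrite /=; case: (odd i).
Qed.

Lemma alternates_rcons P Q s d : alternates P Q (rcons s d) =
  alternates P Q s && (d \in if odd (size s) then Q else P).
Proof.
elim: s P Q => [|e s IHs] P Q /=; first by rewrite andbT.
by rewrite IHs andbA; case: (odd _).
Qed.

Lemma degU1 (N : {set {set T}}) d v : d \notin N ->
  deg (d |: N) v = (v \in d) + deg N v.
Proof.
move=> dN; rewrite degU; last by rewrite disjoints1.
congr (_ + _); rewrite /deg; case: (boolP (v \in d)) => vd.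
  by apply/eqP/cards1P; exists d; apply/setP => e; rewrite !inE;
    case: eqVneq => // ->.
by apply/eqP; rewrite cards_eq0; apply/eqP/setP => e; rewrite !inE;
  case: eqVneq => // ->; apply: negPf.
Qed.

Lemma parity_deg P Q s v : [disjoint P & Q] -> uniq s -> alternates P Q s ->
  parity_count v false s = deg [set d in s | d \in P] v /\
  parity_count v true s = deg [set d in s | d \in Q] v.
Proof.
elim: s P Q => [|d s IHs] P Q dPQ /=.
  by rewrite /deg => _ _; split; apply/esym/eqP; rewrite cards_eq0;
    apply/eqP/setP => e; rewrite !inE.
case/andP=> ds us /andP[dP aQ]; rewrite disjoint_sym in dPQ.
have [IH1 IH2] := IHs _ _ dPQ us aQ.
have dQ : d \notin Q.
  by apply/negP => dQ; have /pred0P/(_ d) := dPQ; rewrite /= dP dQ.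
split.
  rewrite IH2 -degU1; last by rewrite !inE (negPf ds).
  by congr deg; apply/setP => e; rewrite !inE; case: eqVneq => // ->.
rewrite add0n IH1; congr deg; apply/setP => e; rewrite !inE.
by case: eqVneq => // ->; rewrite (negPf dQ) !andbF.
Qed.

End Trails.

(** * Optimality implies condition (c) *)

Section ConditionC.

Variables (T : finType) (G F : rel T).
Hypotheses (hG : simple_graph G) (hF : simple_graph F) (sub : subrel F G).
Hypothesis cF : charted F setT.
Implicit Types (x y z : T) (phi : nat -> T).

Lemma disjoint_LB : [disjoint L F & B G F].
Proof.
by apply/pred0P => d /=; rewrite [d \in B G F]in_setD !in_setU; case: (d \in L F).
Qed.

Lemma disjoint_UB : [disjoint U F & B G F].
Proof.
by apply/pred0P => d /=; rewrite [d \in B G F]in_setD !in_setU;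
  case: (d \in U F); rewrite ?orbT.
Qed.

(** A closed trail of even length has no unbalanced end, so at each vertex it uses as many [L]-edges
    as [B]-edges. *)
Lemma balanced_cycle x p : even_cycle G x p ->
  alternating (L F) (B G F) (trail_edges x p) ->
  {subset trail_edges x p <= L F :|: B G F} /\
  forall v, deg [set d in trail_edges x p | d \in L F] v =
            deg [set d in trail_edges x p | d \in B G F] v.
Proof.
case=> -[pp up] lp ev [b alt].
have LD : L F :\: B G F = L F by apply/setDidPl/disjoint_LB.
have BD : B G F :\: L F = B G F by apply/setDidPl; rewrite disjoint_sym disjoint_LB.
rewrite LD BD in alt; split.
  move=> d /(nthP set0)[i lti <-]; have := alt i lti.
  by rewrite in_setU; case: ifP => _ ->; rewrite ?orbT.
move=> v; have := trail_parity v (proj2 hG) pp; rewrite (negPf ev) lp => /addIn.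
have dis := disjoint_LB.
case: b alt => alt.
  have /alternatesP a : forall i, i < size (trail_edges x p) ->
      nth set0 (trail_edges x p) i \in if odd i then L F else B G F.
    by move=> i /alt; case: (odd i).
  rewrite disjoint_sym in dis.
  by have [-> ->] := parity_deg v dis up a.
have /alternatesP a : forall i, i < size (trail_edges x p) ->
    nth set0 (trail_edges x p) i \in if odd i then B G F else L F.
  by move=> i /alt; case: (odd i).
by have [-> ->] := parity_deg v dis up a.
Qed.

(** As [lambda G] is at most [alpha G * 2], both matchings have exactly [alpha G] edges, before and
    after an exchange on [K]. So they have equally many edges inside [K]. *)
Lemma no_odd_component H H' (K : {set T}) : (H, H') \in B2 G ->
  closed (adj (H :|: H')) K ->
  alpha G * 2 <= #|H| + #|H'| -> ~~ odd (#|restr H K| + #|restr H' K|).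
Proof.
move=> pP clK le.
have le2 := leq_trans (lambda_le G) le.
have h1 := pair_le_alpha pP le2.
have h2 : #|H'| <= alpha G by apply: pair_le_alpha (pair_sym pP) _; rewrite addnC.
have c1 := swap_card K pP; have c2 := swap_card K (pair_sym pP).
have pS := swapped_pair hG pP clK.
have h3 := pair_le_alpha pS; have h4 := pair_le_alpha (pair_sym pS).
have -> : #|restr H' K| = #|restr H K| by lia.
by rewrite addnn odd_double.
Qed.

Hypothesis aE : alpha G * 5 = #|T| * 2.

Lemma optimal_cond_c : cond_c G F.
Proof.
move=> x p ec alt [y [z [yzp y2 z2]]] [c cB].
have [sLB bal] := balanced_cycle ec alt.
set s := trail_edges x p in yzp cB sLB bal.
set CL := [set d in s | d \in L F] in bal;
  set CB := [set d in s | d \in B G F] in cB bal.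
have dUL : [disjoint U F & L F] by rewrite disjoint_sym disjoint_L_U.
have dLB := disjoint_LB; have dUB := disjoint_UB.
have sCL : CL \subset L F by apply/subsetP => d; rewrite inE => /andP[].
have sCB : CB \subset B G F by apply/subsetP => d; rewrite inE => /andP[].
(* [D] is [U F :|: L F] with the [L]-edges of the cycle replaced by its [B]-edges. It is coloured in
   three stages: first [CB], which is assumed bipartite, then the remaining [L]-edges, then
   [U F]. *)
pose D1 := CB :|: (L F :\: CL); pose D := D1 :|: U F.
have d1 : [disjoint CB & L F :\: CL].
  by rewrite disjoint_sym; apply: disjointWl (subsetDl _ _) (disjointWr sCB dLB).
have d2 : [disjoint D1 & U F].
  rewrite -setI_eq0 setIUl setU_eq0 !setI_eq0 disjoint_sym (disjointWr sCB) //=.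
  by rewrite disjoint_sym; apply: disjointWr (subsetDl _ _) dUL.
have degD v : deg D v = if ivertex F 1 v then 1 else 2.
  rewrite -(deg_UL hG hF sub cF) /D (degU _ d2) /D1 (degU _ d1) (degU _ dUL).
  by rewrite -bal [in RHS](degDI (L F) CL) (setIidPr sCL) addnC.
have sD : D \subset edges G.
  rewrite !subUset (U_edges hG sub) (subset_trans sCB (B_edges G F)) !andbT /=.
  exact: subset_trans (subsetDl _ _) (L_edges hG sub).
have sD1 : D1 \subset edges G by apply: subset_trans sD; apply: subsetUl.
have degD2 v : deg D v <= 2 by rewrite degD; case: ifP.
have degD12 v : deg D1 v <= 2 by apply: leq_trans (degD2 v); apply/degS/subsetUl.
have col0 : colorable G CB.
  apply: (koenig hG (c := c)) cB _ => [|v].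
    exact: subset_trans sCB (B_edges G F).
  by apply: leq_trans (degD12 v); apply/degS/subsetUl.
(* An [L]-edge contains a 2-vertex, which has degree 1 in [L F] and, by balance, also in [D1]. *)
have col1 : colorable G D1.
  apply: (colorable_greedy hG (N := L F :\: CL)) => //; first exact: subsetUr.
    move=> d /[dup] dN /setDP[dL _].
    have [v vd v2] : exists2 v, v \in d & ivertex F 2 v.
      by move: dL => /setIdP[_ /exists_inP[v]]; exists v.
    exists v => //; have [phi cphi E] := chart_at_class cF v2.
    have [_ [_ l1 _]] := chart_deg hG hF sub cphi; rewrite -E in l1.
    by have := degDI (L F) CL v; rewrite (setIidPr sCL) l1 /D1 (degU _ d1) -bal.
  rewrite setDUl setDv setU0 (_ : CB :\: _ = CB) //; exact/setDidPl.
have [H [H' [pP UE]]] : colorable G D.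
  apply: (colorable_greedy hG (N := U F)) => //; first exact: subsetUr.
    move=> d /setIdP[_ /exists_inP[v vd v1]]; exists v => //.
    by rewrite degD v1.
  by rewrite setDUl setDv setU0 (_ : D1 :\: _ = D1) //; apply/setDidPl.
(* Equal degrees give equal numbers of edges, by summing over the vertices. *)
have cD : #|D| * 10 = #|T| * 8.
  rewrite -(card_UL hG hF sub cF); congr (_ * _).
  have sUL : U F :|: L F \subset edges G
    by rewrite subUset (U_edges hG sub) (L_edges hG sub).
  apply/eqP; rewrite -(eqn_pmul2r (isT : 0 < 2)) -(sum_deg hG sD) -(sum_deg hG sUL).
  by apply/eqP/eq_bigr => v _; rewrite degD (deg_UL hG hF sub cF).
have cU : #|H| + #|H'| = #|D|.
  rewrite -UE cardsU; case/pairP: (pP) => _ _.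
  by rewrite -setI_eq0 => /eqP->; rewrite cards0 subn0.
have nbr1 v u : ivertex F 1 v -> [set v; u] \in D -> forall w, [set v;
  w] \in D -> w = u.
  move=> v1 vu w vw; have := degD v;
    rewrite v1 (deg_nbrs hG _ sD) => /eqP/cards1P[t E].
  have : u \in [set t] by rewrite -E in_set.
  have : w \in [set t] by rewrite -E in_set.
  by rewrite !inE => /eqP-> /eqP->.
have nbr2 v u u' : ~~ ivertex F 1 v -> u != u' -> [set v; u] \in D -> [set v;
  u'] \in D ->
    forall w, [set v; w] \in D -> w \in [set u; u'].
  move=> v1 uu' vu vu' w vw; have := degD v;
    rewrite (negPf v1) (deg_nbrs hG _ sD) => cN.
  suff -> : [set u; u'] = [set w | [set v; w] \in D] by rewrite in_set.
  apply/eqP; rewrite eqEcard cN cards2 uu' andbT.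
  by rewrite subUset !sub1set; apply/andP; split; rewrite in_set.
have [phi cphi Ey] := chart_at_class cF y2;
  have [psi cpsi Ez] := chart_at_class cF z2.
pose a := phi 0; pose e := psi 0.
have yzB : [set y; z] \in CB.
  rewrite inE yzp /=; have := sLB _ yzp; rewrite in_setU => /orP[|//].
  rewrite Ey (chart_L1 hF _ cphi) => /eqP E.
  by rewrite E (chart_iv cphi) in z2.
have yzD : [set y; z] \in D by rewrite !in_setU yzB.
have ayD : [set y; a] \in D by rewrite !in_setU Ey (chart_U1 hF _ cphi) eqxx !orbT.
have ezD : [set z; e] \in D by rewrite !in_setU Ez (chart_U1 hF _ cpsi) eqxx !orbT.
have a1 : ivertex F 1 a by rewrite (chart_iv cphi).
have e1 : ivertex F 1 e by rewrite (chart_iv cpsi).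
have iv12 v : ivertex F 2 v -> ~~ ivertex F 1 v by rewrite /ivertex => /eqP->.
have az : a != z by apply: contraTneq a1 => ->; apply: iv12.
have ye : y != e by apply: contraTneq e1 => <-; apply: iv12.
have ay : a != y by apply: contraTneq a1 => ->; apply: iv12.
have ze : z != e by apply: contraTneq e1 => <-; apply: iv12.
have yz : y != z by apply: (edge_neq hG); rewrite -(edgeE hG) (subsetP sD).
have ae : a != e.
  apply: contraNneq yz => E; apply/eqP; apply: (nbr1 a) => //;
    last by rewrite setUC.
  by rewrite E setUC.
(* The 2-2 edge [y z] and the [U]-edges at its ends use up the degrees of [a], [y], [z] and [e], so
   these four vertices are closed in [D]. *)
pose K := a |: (y |: [set z; e]).
have clK : closed (adj (H :|: H')) K.
  rewrite UE; apply: intro_closed; first exact: connect_adj_sym.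
  move=> u w; rewrite /adj => uw; rewrite [u \in K]in_setU1 in_setU1 in_set2.
  case/or4P=> /eqP E; rewrite {}E in uw.
  - have -> : w = y by apply: (nbr1 a) => //; rewrite setUC.
    by rewrite !inE eqxx orbT.
  - by have := nbr2 y a z (iv12 _ y2) az ayD yzD w uw; rewrite !inE => /orP[]->;
    rewrite ?orbT.
  - have zyD : [set z; y] \in D by rewrite setUC.
    by have := nbr2 z y e (iv12 _ z2) ye zyD ezD w uw; rewrite !inE => /orP[]->;
      rewrite ?orbT.
  - have -> : w = z by apply: (nbr1 e) => //; rewrite setUC.
    by rewrite !inE eqxx !orbT.
suff E3 : #|restr H K| + #|restr H' K| = 3.
  have := no_odd_component pP clK; rewrite E3 cU => /(_ _)/negP; apply=> //.
  by rewrite -(leq_pmul2r (isT : 0 < 5)) mulnAC aE -(leq_pmul2r (isT : 0 < 2))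
    -!mulnA cD.
have cK (N : {set {set T}}) : N \subset H :|: H' -> matching G N ->
    #|restr N K| * 2 = \sum_(v in K) (v \in cover N).
  move=> sN mN; rewrite -(card_cover hG (matching_sub (restr_sub N K) mN)).
  rewrite -big_mkcondr sum1dep_card; apply: eq_card => v; rewrite [RHS]in_set.
  case: (boolP (v \in K)) => vK /=; first exact: (cover_restr_closed hG pP clK sN).
  by apply: contraNF vK => /cover_restr.
have [mH mH' _] := pairP _ _ _ pP.
have dv v : (v \in cover H) + (v \in cover H') = if ivertex F 1 v then 1 else 2.
  by rewrite -(pair_deg hG _ pP) UE degD.
have aK : a \notin y |: [set z; e] by rewrite !inE !negb_or ay az ae.
have yK : y \notin [set z; e] by rewrite !inE !negb_or yz ye.
have zK : z \notin [set e] by rewrite inE.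
(* The degrees over [K] add up to 1 + 2 + 2 + 1, twice the number of edges inside [K]. *)
apply/eqP; rewrite -(eqn_pmul2r (isT : 0 < 2)) mulnDl (cK H (subsetUl _ _) mH).
rewrite (cK H' (subsetUr _ _) mH') -big_split /= (eq_bigr _ (fun v _ => dv v)).
rewrite /K !big_setU1 //= big_set1 a1 e1.
by rewrite (negPf (iv12 _ y2)) (negPf (iv12 _ z2)).
Qed.

End ConditionC.

(** * Alternating closed trails in a balanced pair of edge sets *)

Section BalancedTrail.

Variables (T : finType) (G : rel T) (P Q : {set {set T}}).
Hypotheses (hG : simple_graph G) (dPQ : [disjoint P & Q]).
Hypotheses (sP : P \subset edges G) (sQ : Q \subset edges G).
Hypothesis bal : forall v, deg P v = deg Q v.

Lemma unused_edge (N : {set {set T}}) (s : seq {set T}) v : N \subset edges G ->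
  deg [set d in s | d \in N] v < deg N v -> exists w, [/\ [set v;
    w] \in N, G v w & [set v; w] \notin s].
Proof.
move=> sN lt; have [d /andP[/setIdP[dN vd] ds]] :
    exists d, (d \in [set d in N | v \in d]) && (d \notin s).
  apply/existsP; apply: contraLR lt => /existsPn h; rewrite -leqNgt.
  apply/subset_leq_card/subsetP => d dv; have := h d; rewrite dv /= negbK => ds.
  by case/setIdP: dv => dN vd; apply/setIdP; split=> //; apply/setIdP.
have [w [Gvw E]] := edge_at hG (subsetP sN _ dN) vd.
by exists w; rewrite -E.
Qed.

Lemma trail_edges_rcons (x w : T) p :
  trail_edges x (rcons p w) = rcons (trail_edges x p) [set last x p; w].
Proof. by elim: p x => [|y p IHp] x //=; rewrite -IHp. Qed.

Lemma size_trail_edges (x : T) p : size (trail_edges x p) = size p.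
Proof. by rewrite /trail_edges size_pairmap. Qed.

Lemma alternates_sub (s : seq {set T}) d : alternates P Q s -> d \in s ->
  d \in P :|: Q.
Proof.
move=> /alternatesP h /(nthP set0)[i lti <-]; have := h i lti.
by rewrite in_setU; case: ifP => _ ->; rewrite ?orbT.
Qed.

Lemma extend_trail n y z p : #|P :|: Q| < n + size p ->
  trail G y (z :: p) -> alternates P Q (trail_edges y (z :: p)) ->
  exists p', even_cycle G y (z :: p') /\ alternates P Q (trail_edges y (z :: p')).
Proof.
elim: n p => [|n IHn] p le tr alt; have [pp up] := tr.
  have : size (trail_edges y (z :: p)) <= #|P :|: Q|.
    rewrite -(card_uniqP up); apply/subset_leq_card/subsetP => d.
    exact: alternates_sub.
  by rewrite size_trail_edges /= => /leq_trans/(_ (ltnW le)); rewrite add0n ltnn.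
set s := trail_edges y (z :: p) in up alt.
pose v := last y (z :: p).
have [cP cQ] := parity_deg v dPQ up alt.
have := trail_parity v (proj2 hG) pp; rewrite -/s cP cQ -/v eqxx.
have ext w N : (if odd (size s) then Q else P) = N -> [set v; w] \in N -> G v w ->
    [set v; w] \notin s ->
    exists p', even_cycle G y (z :: p') /\ alternates P Q (trail_edges y (z :: p')).
  move=> NE wN Gvw ws; apply: (IHn (rcons p w)).
  - by rewrite size_rcons addnS -addSn.
  - split; first by rewrite -rcons_cons rcons_path pp.
    by rewrite -rcons_cons trail_edges_rcons rcons_uniq ws.
  - by rewrite -rcons_cons trail_edges_rcons alternates_rcons alt NE.
have sz : size s = size (z :: p) by rewrite size_trail_edges.
case: ifP => [od E|ev E].
  have lt : deg [set d in s | d \in Q] v < deg Q v.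
    rewrite -bal; apply: leq_trans (degS _ (_ : [set d in s | d \in P] \subset P)).
      by rewrite E addn1 ltnS leq_addr.
    by apply/subsetP => d /setIdP[].
  have [w [wN Gvw ws]] := unused_edge sQ lt.
  by apply: ext wN Gvw ws; rewrite sz od.
have [vy|vy] := eqVneq v y.
  by exists p; split=> //; split=> //; rewrite ev.
rewrite (negPf vy) addn0 in E.
have lt : deg [set d in s | d \in P] v < deg P v.
  rewrite bal; apply: leq_trans (degS _ (_ : [set d in s | d \in Q] \subset Q)).
    by rewrite -E addn1.
  by apply/subsetP => d /setIdP[].
have [w [wN Gvw ws]] := unused_edge sP lt.
by apply: ext wN Gvw ws; rewrite sz ev.
Qed.

Lemma balanced_trail y z : [set y; z] \in P ->
  exists p, even_cycle G y (z :: p) /\ alternates P Q (trail_edges y (z :: p)).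
Proof.
move=> yzP; apply: (@extend_trail #|P :|: Q|.+1 y z [::]); first by rewrite addn0.
  by split; rewrite /= -?(edgeE hG) ?(subsetP sP) ?andbT.
by rewrite /= yzP.
Qed.

End BalancedTrail.

(** * The three conditions determine [alpha] and [beta] *)

Section Sufficiency.

Variables (T : finType) (G F : rel T).
Hypotheses (hG : simple_graph G) (hF : simple_graph F) (sub : subrel F G).
Hypothesis cF : charted F setT.
Hypotheses (ca : cond_a G F) (cb : cond_b G F) (cc : cond_c G F).
Implicit Types (x y z : T) (phi : nat -> T).

Let sF : symmetric F := proj1 hF.

Lemma end_nbr phi z : chart F phi -> G (phi 0) z -> z = phi 1 \/ z = phi 2.
Proof.
move=> cphi Gz; have iv : ivertex F 1 (phi 0) by rewrite (chart_iv cphi).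
have : [set phi 0; z] \notin B G F.
  by apply/negP => dB; apply: (ca iv); exists [set phi 0; z]; rewrite ?set21.
rewrite (in_B F hG) Gz negbK (chart_L0 hF _ cphi) (chart_U0 hF _ cphi).
rewrite (chart_Delta0 hG hF _ cphi) Gz /= => /orP[]/eqP->; by [left | right].
Qed.

Lemma middle_nbr phi z : chart F phi -> G (phi 0) (phi 2) -> G (phi 1) z ->
  z = phi 0 \/ z = phi 2.
Proof.
move=> cphi G02 Gz; have iv : ivertex F 1 (phi 0) by rewrite (chart_iv cphi).
have iv2 : ivertex F 2 (phi 1) by rewrite (chart_iv cphi).
have : [set phi 1; z] \notin B G F.
  apply/negP => dB; apply: (cb iv _ iv2).
  - by exists [set phi 0; phi 2];
    rewrite ?set21 // (chart_Delta0 hG hF _ cphi) G02 eqxx.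
  - by rewrite (chart_U0 hF _ cphi).
  - by exists [set phi 1; z]; rewrite ?set21.
rewrite (in_B F hG) Gz negbK (chart_L1 hF _ cphi) (chart_U1 hF _ cphi).
rewrite (chart_Delta1 hG _ cphi) orbF /= => /orP[]/eqP->; by [right | left].
Qed.

Lemma DeltaP d : d \in Delta G F ->
  exists phi, [/\ chart F phi, d = [set phi 0; phi 2] & G (phi 0) (phi 2)].
Proof.
case/setIdP=> dE /existsP[x /existsP[y /and3P[/eqP E x1 xb]]].
have [phi cphi Ex] := chart_at_class cF x1.
move: xb; rewrite Ex (chart_base sF _ cphi) => /eqP Ey.
by exists phi; rewrite -Ex -Ey -E -(edgeE hG) -E.
Qed.

(* By (a) and (b) the vertices [phi 0] and [phi 1] of the triangle spanned by a
   [Delta]-edge have no neighbour outside it. *)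
Lemma remove_Delta_edge H H' d : (H, H') \in B2 G -> d \in H -> d \in Delta G F ->
  exists H1, [/\ (H1, H') \in B2 G, #|H1| = #|H| & H1 :&: Delta G F \subset (H
    :&: Delta G F) :\ d].
Proof.
move=> pP dH /DeltaP[phi [cphi dE G02]].
have [mH mH' _] := pairP _ _ _ pP.
set a := phi 0 in dE G02; set c := phi 2 in dE G02; pose b := phi 1.
have ab : a <> b by move/(cphi.1 0 1 isT isT).
have bc : b <> c by move/(cphi.1 1 2 isT isT).
have ac : a <> c by move/(cphi.1 0 2 isT isT).
have acH : [set a; c] \in H by rewrite -dE.
have caH : [set c; a] \in H by rewrite setUC.
(* The only possible mates of [b] are [a] and [c], which [d] matches with each other. *)
have bH : b \notin cover H.
  apply/negP => /(mate hG mH)[z Hbz].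
  have [E|E] := middle_nbr cphi G02 (matching_adj hG mH Hbz);
    rewrite E setUC in Hbz.
    by case: bc; apply: mate_uniq mH Hbz acH.
  by case: ab; apply/esym; apply: mate_uniq mH Hbz caH.
have pD : (H :\ d, H') \in B2 G by apply: pair_sub pP _ _; rewrite ?subD1set.
have aD : a \notin cover (H :\ d) by apply: cover_del mH dH _; rewrite dE set21.
have cD : c \notin cover (H :\ d) by apply: cover_del mH dH _; rewrite dE set22.
have bD : b \notin cover (H :\ d) by apply: contra bH;
  apply/subsetP/coverS/subD1set.
have add w : w \notin cover (H :\ d) -> G b w -> [set b; w] \notin H' ->
    exists H1, [/\ (H1, H') \in B2 G, #|H1| = #|H| & H1 :&: Delta G F \subset (H
      :&: Delta G F) :\ d].
  move=> wD Gbw nH'; exists ([set b; w] |: (H :\ d)); split; first exact: pair_add.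
    rewrite cardsU1 (cardsD1 d H) dH (_ : _ \notin _) //.
    by apply: contra bD => /adj_cover[].
  apply/subsetP => e; rewrite !in_setI in_setU1 in_setD1 => /andP[/orP[/eqP->|]].
    by rewrite (chart_Delta1 hG _ cphi).
  by rewrite !in_setD1 in_setI => /andP[-> ->] ->.
(* The matching [H'] contains at most one of the edges [b a] and [b c]; the other one replaces
   [d]. *)
have [abH'|abH'] := boolP ([set b; a] \in H'); last first.
  by apply: (add a) => //; apply/sub; rewrite (chart_nb cphi).
apply: (add c) => //; first by apply/sub; rewrite (chart_nb cphi).
by apply/negP => bcH'; apply: ac; apply: mate_uniq mH' abH' bcH'.
Qed.

(** Each replacement lowers the number of [Delta]-edges in the first matching and leaves the second
    one unchanged, so the two matchings can be treated in turn. *)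
Lemma remove_Delta_half H H' : (H, H') \in B2 G ->
  exists H1, [/\ (H1, H') \in B2 G, #|H1| = #|H| & [disjoint H1 & Delta G F]].
Proof.
move: {2}#|H :&: Delta G F| (leqnn #|H :&: Delta G F|) => n.
elim: n H => [|n IHn] H le pP.
  exists H; split=> //; rewrite -setI_eq0 -cards_eq0 -leqn0; exact: le.
have [H0|[d /setIP[dH dD]]] := set_0Vmem (H :&: Delta G F).
  by exists H; split=> //; rewrite -setI_eq0 H0.
have [H1 [p1 c1 s1]] := remove_Delta_edge pP dH dD.
have [|H2 [p2 c2 s2]] := IHn H1 _ p1; last by exists H2; rewrite c2 c1.
rewrite -ltnS; apply: leq_trans le;
  rewrite (cardsD1 d (H :&: _)) in_setI dH dD add1n ltnS.
exact: subset_leq_card.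
Qed.

Lemma remove_Delta H H' : (H, H') \in B2 G -> exists H1 H1',
  [/\ (H1, H1') \in B2 G, #|H1| = #|H|, #|H1'| = #|H'| &
      [disjoint H1 :|: H1' & Delta G F]].
Proof.
move=> pP; have [H1 [p1 c1 d1]] := remove_Delta_half pP.
have [H1' [p2 c2 d2]] := remove_Delta_half (pair_sym p1).
exists H1, H1'; split=> //; first exact: pair_sym.
by rewrite -setI_eq0 setIUl setU_eq0 !setI_eq0 d1.
Qed.

(** * Pairs that avoid [Delta] *)

Section NoDelta.

Variables (H H' : {set {set T}}).
Hypotheses (pP : (H, H') \in B2 G) (nD : [disjoint H :|: H' & Delta G F]).
Let D := H :|: H'.

Lemma pair_edges : D \subset edges G.
Proof.
have [mH mH' _] := pairP _ _ _ pP.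
by apply/subsetP => d /setUP[/(matching_edge mH)|/(matching_edge mH')].
Qed.

Lemma pair_end_nbr phi z : chart F phi -> [set phi 0; z] \in D -> z = phi 1.
Proof.
move=> cphi dD; have := subsetP pair_edges _ dD; rewrite (edgeE hG) => Gz.
have [//|E] := end_nbr cphi Gz.
have /pred0P/(_ [set phi 0; z]) := nD; rewrite /= dD (chart_Delta0 hG hF _ cphi).
by rewrite Gz E eqxx.
Qed.

Lemma pair_deg_le x : deg D x <= if ivertex F 1 x then 1 else 2.
Proof.
case: ifP => [x1|_]; last by rewrite (pair_deg hG _ pP); case: (_ \in _);
  case: (_ \in _).
have [phi cphi ->] := chart_at_class cF x1; rewrite (deg_nbrs hG _ pair_edges).
rewrite -(cards1 (phi 1)); apply/subset_leq_card/subsetP => z; rewrite in_set => dD.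
by rewrite (pair_end_nbr cphi dD) set11.
Qed.

Lemma pair_card : #|D| = #|H| + #|H'|.
Proof.
rewrite cardsU; case/pairP: pP => _ _; rewrite -setI_eq0 => /eqP->.
by rewrite cards0 subn0.
Qed.

Lemma pair_card_le : (#|H| + #|H'|) * 10 <= #|T| * 8.
Proof.
rewrite -pair_card -(leq_pmul2r (isT : 0 < 2)) mulnAC -(sum_deg hG pair_edges)
  -mulnA.
rewrite -(sum_deg_weight hF cF) leq_pmul2r //.
by apply: leq_sum => x _; apply: pair_deg_le.
Qed.

Hypothesis full : (#|H| + #|H'|) * 10 = #|T| * 8.

(** The degree bounds of [pair_deg_le] have the same sum as the degrees, so each of them is
    attained. *)
Lemma pair_deg_eq x : deg D x = if ivertex F 1 x then 1 else 2.
Proof.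
have S : \sum_x deg D x = \sum_x (if ivertex F 1 x then 1 else 2).
  apply/eqP; rewrite -(eqn_pmul2r (isT : 0 < 10)) (sum_deg_weight hF cF).
  by rewrite (sum_deg hG pair_edges) pair_card mulnAC full -mulnA.
have := leqif_sum (fun x (_ : true) => leqif_geq (pair_deg_le x)).
case=> _; rewrite S eqxx => /esym/forallP/(_ x) /=.
by move=> le; apply/eqP; rewrite eqn_leq pair_deg_le.
Qed.

Lemma pair_covers_2 x : ivertex F 2 x -> (x \in cover H) && (x \in cover H').
Proof.
move=> x2; have := pair_deg_eq x; rewrite (pair_deg hG _ pP).
have -> : ivertex F 1 x = false by move: x2; rewrite /ivertex => /eqP->.
by case: (_ \in _); case: (_ \in _).
Qed.

(** Without 2-2 edges in [D], distinct 2-vertices lie in distinct edges of [N], and four vertices in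
    ten are 2-vertices. *)
Lemma card_cover_2 (N : {set {set T}}) : N \subset D -> matching G N ->
  (forall y z, ivertex F 2 y -> ivertex F 2 z -> [set y; z] \notin D) ->
  (forall x, ivertex F 2 x -> x \in cover N) -> #|T| * 4 <= #|N| * 10.
Proof.
move=> sN mN no22 cov; rewrite -(card_2vertices sF cF) leq_pmul2r //.
have inj : {in [set x | ivertex F 2 x] &, injective (pblock N)}.
  move=> x y; rewrite !in_set => x2 y2 E; apply/eqP; apply: contraT => xy.
  have bN := pblock_mem (cov x x2).
  have xb : x \in pblock N x by rewrite mem_pblock cov.
  have yb : y \in pblock N x by rewrite E mem_pblock cov.
  have [z [_ bE]] := edge_at hG (matching_edge mN bN) xb.
  have Ez : y = z by move: yb; rewrite bE => /set2P[E'|//]; rewrite E' eqxx in xy.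
  by have := no22 x y x2 y2; rewrite Ez -bE (subsetP sN).
rewrite -(card_in_imset inj); apply/subset_leq_card/subsetP => d /imsetP[x].
by rewrite in_set => x2 ->; apply/pblock_mem/cov.
Qed.

Lemma no_22_edge y z : ivertex F 2 y -> ivertex F 2 z -> [set y; z] \notin D.
Proof.
move=> y2 z2; apply/negP => yzD.
(* A 1-vertex has degree 1 in [D], and its only possible neighbour there is its [U]-mate. *)
have UD : U F \subset D.
  apply/subsetP => d /[dup] dU /setIdP[_ /exists_inP[x xd x1]].
  have [phi cphi Ex] := chart_at_class cF x1.
  have [w [_ E]] := edge_at hG (subsetP (U_edges hG sub) _ dU) xd.
  have : 0 < deg D x by rewrite pair_deg_eq x1.
  rewrite deg_gt0 => /bigcupP[d' d'D xd'].
  have [w' [_ E']] := edge_at hG (subsetP pair_edges _ d'D) xd'.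
  have Ew : w = phi 1 by apply/eqP; rewrite -(chart_U0 hF _ cphi) -Ex -E.
  have Ew' : w' = phi 1 by apply: (pair_end_nbr cphi); rewrite -Ex -E'.
  by rewrite E Ew -Ew' -E'.
(* As [D] contains [U F] and avoids [Delta], its symmetric difference with [U F :|: L F] consists of
   [B]-edges, forming [P], and [L]-edges, forming [Q]. Equal degrees make the two balanced. *)
pose P := D :&: B G F; pose Q := L F :\: D.
have dPQ : [disjoint P & Q].
  apply: disjointWl (subsetIr _ _) _; rewrite disjoint_sym.
  by apply: disjointWl (subsetDl _ _) _; apply: disjoint_LB.
have sP : P \subset edges G := subset_trans (subsetIl _ _) pair_edges.
have sQ : Q \subset edges G := subset_trans (subsetDl _ _) (L_edges hG sub).
have DE : D :\: (U F :|: L F) = P.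
  apply/setP => d; rewrite in_setD in_setI andbC.
  case: (boolP (d \in D)) => //= dD; rewrite [RHS]in_setD.
  have /pred0P/(_ d) /= := nD;
    rewrite (subsetP pair_edges _ dD) andbT dD /= !in_setU => ->.
  by rewrite orbF orbC.
have ULE : (U F :|: L F) :\: D = Q.
  by rewrite setDUl (eqP (_ : U F :\: D == set0)) ?setD_eq0 // set0U.
have bal v : deg P v = deg Q v.
  have := deg_UL hG hF sub cF v; rewrite -pair_deg_eq.
  rewrite (degDI (U F :|: L F) D) (degDI D (U F :|: L F)) setIC DE ULE.
  by move/addnI.
have yzP : [set y; z] \in P.
  rewrite -DE in_setD yzD andbT in_setU negb_or.
  have [phi cphi Ey] := chart_at_class cF y2.
  rewrite Ey (chart_U1 hF _ cphi) (chart_L1 hF _ cphi).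
  by apply/andP; split; apply: contraTneq z2 => ->; rewrite (chart_iv cphi).
have [p [ec alt]] := balanced_trail hG dPQ sP sQ bal yzP.
have [mH mH' _] := pairP _ _ _ pP.
(* The [B]-edges of the cycle all lie in [D], the union of two matchings, so they form a bipartite
   graph, against (c). *)
have [c cD] := two_matchings_bipartite hG mH mH'.
apply: (cc ec) => [||].
- exists true => i /(alternatesP _ _ _ alt); rewrite addbT.
  case: (odd i) => /= [/setDP[dL _]|/setIP[_ dB]]; rewrite in_setD.
    rewrite dL andbT; apply/negP => dB.
    by have /pred0P := disjoint_LB G F;
      move/(_ (nth set0 (trail_edges y (z :: p)) i)); rewrite /= dL dB.
  rewrite dB andbT; apply/negP => dL.
  by have /pred0P := disjoint_LB G F;
    move/(_ (nth set0 (trail_edges y (z :: p)) i)); rewrite /= dL dB.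
- by exists y, z; split=> //; rewrite in_cons eqxx.
exists c => u v /setIdP[uvs uvB]; apply: cD.
have := alternates_sub alt uvs; rewrite in_setU => /orP[/setIP[]//|/setDP[uvL _]].
by have /pred0P/(_ [set u; v]) := disjoint_LB G F; rewrite /= uvL uvB.
Qed.

Lemma full_pair_card : #|H| * 10 = #|T| * 4.
Proof.
have [mH mH' _] := pairP _ _ _ pP.
have c1 : #|T| * 4 <= #|H| * 10.
  apply: (card_cover_2 (subsetUl _ _) mH) => [y z|x /pair_covers_2/andP[]//].
  exact: no_22_edge.
have c2 : #|T| * 4 <= #|H'| * 10.
  apply: (card_cover_2 (subsetUr _ _) mH') => [y z|x /pair_covers_2/andP[]//].
  exact: no_22_edge.
apply/eqP; rewrite eqn_leq c1 andbT -(leq_add2r (#|H'| * 10)) -mulnDl full.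
by rewrite -[8]/(4 + 4) mulnDr leq_add2l.
Qed.

End NoDelta.

(** The sides of [F] give a pair with [8/10] of [#|T|] edges, and no pair has more once [Delta] is
    traded away. So an optimal pair becomes full, and in a full pair each matching has [4/10] of
    [#|T|] edges. *)
Lemma conditions_alpha : alpha G * 5 = #|T| * 2.
Proof.
have [H [H' [pP sE aE]]] := alpha_pair G.
have [N [N' [pN _ _ cN cN']]] := charted_pair hG sF sub cF.
have [H1 [H1' [p1 c1 c1' nD]]] := remove_Delta pP.
have le1 := pair_card_le p1 nD.
have le2 := pair_le_lambda pN.
have full : (#|H1| + #|H1'|) * 10 = #|T| * 8.
  apply/eqP; rewrite eqn_leq le1 c1 c1' sE /= -(cardsT T).
  move: cN cN' le2 {le1}; rewrite cardsT;
    move: #|N| #|N'| #|T| (lambda G) => a b t l.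
  clear; lia.
have := full_pair_card p1 nD full; rewrite c1 aE; clear; lia.
Qed.

Lemma conditions_beta : beta G * 2 = #|T|.
Proof.
have [M [mM _ cM]] := charted_matching hG sF sub cF.
have [M' mM' cM'] := beta_matching G.
apply/eqP; rewrite eqn_leq -{1}cM' -(card_cover hG mM') max_card.
by rewrite -[X in X <= _]cardsT -cM leq_pmul2r // matching_le_beta.
Qed.

End Sufficiency.

(** * The equivalence in terms of natural numbers *)

Section Characterization.

Variables (T : finType) (G : rel T).
Hypotheses (hG : simple_graph G) (hiso : no_isolated G).

Lemma extremal_pair (M : {set {set T}}) : exists H H',
  [/\ (H, H') \in B2 G, #|H| + #|H'| = lambda G, #|H| = alpha G &
   forall H1 H1', (H1, H1') \in B2 G -> #|H1| + #|H1'| = lambda G ->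
     #|H1| = alpha G -> #|M :&: H1| <= #|M :&: H|].
Proof.
have [H0 [H0' [p0 s0 a0]]] := alpha_pair G.
pose opt (P : {set {set T}} * {set {set T}}) :=
  [&& P \in B2 G, #|P.1| + #|P.2| == lambda G & #|P.1| == alpha G].
have opt0 : opt (H0, H0') by rewrite /opt p0 /= s0 a0 !eqxx.
case: (arg_maxnP (fun P : {set {set T}} * {set {set T}} => #|M :&: P.1|) opt0).
move=> [H H'] /and3P[/= p1 /eqP s1 /eqP a1] mx; exists H, H';
  split=> // H1 H1' pP sE aE.
by apply: (mx (H1, H1')); rewrite /opt pP /= sE aE !eqxx.
Qed.

Lemma ratio_charted : beta G * 4 = alpha G * 5 -> exists F,
  [/\ simple_graph F, subrel F G, charted F setT & alpha G * 5 = #|T| * 2].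
Proof.
move=> ratio; have [M mM cM] := beta_matching G.
have [H [H' [pP sE aE mx]]] := extremal_pair M.
have cE : alpha G * 5 = #|cover M| * 2.
  by rewrite (card_cover hG mM) cM -ratio -mulnA.
have cF := extremal_charted hG mM cM pP sE aE mx ratio.
set F := extremal_forest M H H' in cF.
have sF : symmetric F := @extremal_forest_sym _ M H H'.
have sub : subrel F G := extremal_forest_sub hG mM pP.
(* An uncovered [z] has a neighbour [y]. A covered [y] would give an edge leaving the spanners,
   against [charted_no_exit]; an uncovered one would allow [M] to be enlarged. *)
have full : cover M = setT.
  apply/setP => z; rewrite in_setT; apply: contraT => zM; have [y Gzy] := hiso z.
  have [yM|yM] := boolP (y \in cover M).
    by have := charted_no_exit hG sF sub cF cE zM yM; rewrite Gzy.
  have := matching_le_beta (matching_add hG mM Gzy zM yM).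
  have nM : [set z; y] \notin M by apply: contra zM => /adj_cover[].
  by rewrite cardsU1 nM cM add1n ltnn.
rewrite full in cF cE; rewrite cardsT in cE.
exists F; split=> //; split=> // x; apply/negP => /sub.
by rewrite (proj2 hG).
Qed.

Lemma ratio_forest : beta G * 4 = alpha G * 5 -> exists F : rel T,
  [/\ spanning_S_forest G F, cond_a G F, cond_b G F & cond_c G F].
Proof.
case/ratio_charted=> F [hF sub cF aE]; have [sF irF] := hF.
have aE' : alpha G * 5 = #|[set: T]| * 2 by rewrite cardsT.
exists F; split.
- by split=> //; apply: charted_S_forest.
- move=> u u1 [d dB ud]; have [phi cphi E] := chart_at_class cF u1.
  have [z [Gz dE]] := edge_at hG (subsetP (B_edges G F) _ dB) ud.
  rewrite {}dE {}E in Gz dB; move: dB; rewrite (in_B F hG) Gz.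
  rewrite (chart_U0 hF _ cphi) (chart_Delta0 hG hF _ cphi) Gz.
  case: (nbr_of_end hG sF sub cF aE' cphi (subsetT _) (in_setT z) Gz) => ->;
    by rewrite eqxx !orbT.
- move=> u w u1 [d dD ud] w2 uwU [e eB we].
  have [phi cphi E] := chart_at_class cF u1; subst u.
  move: uwU; rewrite (chart_U0 hF _ cphi) => /eqP E; subst w.
  have dE : d \in edges G by case/setIdP: dD.
  have [v [Gv E]] := edge_at hG dE ud.
  move: dD; rewrite E (chart_Delta0 hG hF _ cphi) => /andP[_ /eqP E2]; subst v.
  have [z [Gz E1]] := edge_at hG (subsetP (B_edges G F) _ eB) we.
  move: eB; rewrite E1 (in_B F hG) Gz (chart_U1 hF _ cphi) (chart_L1 hF _ cphi).
  case: (nbr_of_middle hG sF sub cF aE' cphi (subsetT _) (in_setT z) Gv Gz) => ->;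
    by rewrite eqxx ?orbT.
- exact: optimal_cond_c.
Qed.

Lemma forest_ratio F : spanning_S_forest G F -> cond_a G F -> cond_b G F ->
  cond_c G F ->
  alpha G * 5 = #|T| * 2 /\ beta G * 2 = #|T|.
Proof.
move=> [hS sub] ca cb cc; have cF := S_forest_charted hS; have [hF _ _] := hS.
split; first exact: conditions_alpha ca cb cc.
exact: conditions_beta sub cF.
Qed.

End Characterization.

Import GRing.Theory Num.Theory.
Local Open Scope ring_scope.

Theorem mainTheorem1 (T : finType) (G : rel T) (hT : (0 < #|T|)%N)
    (hG : simple_graph G) (hiso : no_isolated G) :
  (beta G)%:R / (alpha G)%:R = 5%:R / 4%:R :> rat <->
  exists F : rel T,
    [/\ spanning_S_forest G F, cond_a G F, cond_b G F & cond_c G F].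
Proof.
split=> [E|[F [hS ca cb cc]]].
  apply: ratio_forest => //.
  (* Division by 0 yields 0 in [rat], so the quotient could not be 5/4. *)
  have a0 : (alpha G)%:R != 0 :> rat.
    by apply/eqP => a0; move/eqP: E; rewrite a0 invr0 mulr0.
  by move/eqP: E; rewrite eqr_div // -!natrM eqr_nat [(5 * _)%N]mulnC => /eqP.
have [aE bE] := forest_ratio hG hS ca cb cc.
(* Here [alpha G] is positive because it is [2/5] of the number of vertices. *)
have a0 : (alpha G)%:R != 0 :> rat.
  by rewrite pnatr_eq0 -lt0n -(ltn_pmul2r (isT : (0 < 5)%N)) mul0n aE muln_gt0 hT.
by apply/eqP; rewrite eqr_div // -!natrM eqr_nat [(5 * _)%N]mulnC aE -bE -mulnA.
Qed.
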